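(* Let $f\in\mathcal W_{\mathbb H,+}$. The following are equivalent: (i) the function $f$ is invertible in $\mathcal W_{\mathbb H,+}$ (with respect to the $\star$-product); (ii) let $i$ be any fixed element of $\mathbb S$ (with $j\in\mathbb S$ orthogonal to $i$ and $\omega=\omega_{i,j}$); then $\det\big(\omega(f)(z)\big)\neq0$ for all $z\in\overline{\mathbb B\cap\mathbb C_i}$; (iii) the function $f$ does not vanish on $\overline{\mathbb B}$, i.e. $f(p)\neq 0$ for every $p\in\overline{\mathbb B}$.
   Context: $\mathbb H$ is the real algebra of quaternions, $|\cdot|$ the quaternionic modulus, $\mathbb S=\{q\in\mathbb H: q^2=-1\}$, $\mathbb B=\{p\in\mathbb H:|p|<1\}$ with closure $\overline{\mathbb B}$. For $i\in\mathbb S$, $\mathbb C_i=\{x+iy: x,y\in\mathbb R\}$, identified with $\mathbb C$. Two elements $i,j\in\mathbb S$ are orthogonal if $ij+ji=0$; then every quaternion is uniquely $q=z+wj$ with $z,w\in\mathbb C_i$, and $\chi=\chi_{i,j}:\mathbb H\to\mathbb C^{2\times2}$ is the injective ring homomorphism $\chi(z+wj)=\begin{pmatrix} z& w\\ -\overline w&\overline z\end{pmatrix}$. The quaternionic Wiener algebra $\mathcal W_{\mathbb H}$ consists of the functions $f(p)=\sum_{u\in\mathbb Z}p^uf_u$ with $f_u\in\mathbb H$ and $\sum_{u\in\mathbb Z}|f_u|<\infty$, with product $(f\star g)(p)=\sum_{u\in\mathbb Z}p^u\big(\sum_{k\in\mathbb Z}f_{u-k}g_k\big)$ and unit $1$.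 $\mathcal W_{\mathbb H,+}$ is the subalgebra of those $f$ with $f_u=0$ for $u<0$; its elements $f(p)=\sum_{n\ge 0}p^nf_n$ are defined and continuous on $\overline{\mathbb B}$. For $f\in\mathcal W_{\mathbb H,+}$ with $f_n=a_n+b_nj$, $a_n,b_n\in\mathbb C_i$, put $a(z)=\sum_{n\ge0}z^na_n$, $b(z)=\sum_{n\ge0}z^nb_n$ and $$\omega(f)(z)=\omega_{i,j}(f)(z)=\begin{pmatrix}a(z)&b(z)\\-\overline{b(\bar z)}&\overline{a(\bar z)}\end{pmatrix}=\sum_{n\ge0}z^n\chi(f_n),\qquad z\in\mathbb C_i,\ |z|\le1.$$ *)

(* Defs.v *)
From HB Require Import structures.
From mathcomp Require Import all_boot all_order all_algebra.
From mathcomp Require Import ring lra.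
From mathcomp Require Import all_classical all_reals all_analysis.
From mathcomp Require Import complex.
Set Implicit Arguments.
Unset Strict Implicit.
Unset Printing Implicit Defensive.
Import Order.TTheory GRing.Theory Num.Theory.
Import numFieldNormedType.Exports.
Local Open Scope classical_set_scope.
Local Open Scope ring_scope.

Record quaternion (R : Type) := Quaternion { q0 : R; q1 : R; q2 : R; q3 : R }.

Definition quaternion_tuple (R : Type) (q : quaternion R) : R * R * R * R :=
  (q0 q, q1 q, q2 q, q3 q).
Definition tuple_quaternion (R : Type) (t : R * R * R * R) : quaternion R :=
  let: (a, b, c, d) := t in Quaternion a b c d.
Lemma quaternion_tupleK (R : Type) :
  cancel (@quaternion_tuple R) (@tuple_quaternion R).
Proof. by case. Qed.

HB.instance Definition _ (R : choiceType) :=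
  Choice.copy (quaternion R) (can_type (@quaternion_tupleK R)).

Section QuaternionAlgebra.
Variable R : realType.
Local Notation H := (quaternion R).
Implicit Types (p q r : H) (x y : R).

Definition addq p q : H :=
  Quaternion (q0 p + q0 q) (q1 p + q1 q) (q2 p + q2 q) (q3 p + q3 q).
Definition oppq p : H := Quaternion (- q0 p) (- q1 p) (- q2 p) (- q3 p).
Definition zeroq : H := Quaternion 0 0 0 0.
Definition oneq : H := Quaternion 1 0 0 0.
Definition mulq p q : H :=
  Quaternion
    (q0 p * q0 q - q1 p * q1 q - q2 p * q2 q - q3 p * q3 q)
    (q0 p * q1 q + q1 p * q0 q + q2 p * q3 q - q3 p * q2 q)
    (q0 p * q2 q - q1 p * q3 q + q2 p * q0 q + q3 p * q1 q)
    (q0 p * q3 q + q1 p * q2 q - q2 p * q1 q + q3 p * q0 q).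
Definition scaleq x q : H :=
  Quaternion (x * q0 q) (x * q1 q) (x * q2 q) (x * q3 q).

Fact addqA : associative addq.
Proof. by move=> [? ? ? ?] [? ? ? ?] [? ? ? ?]; congr Quaternion => /=; ring. Qed.
Fact addqC : commutative addq.
Proof. by move=> [? ? ? ?] [? ? ? ?]; congr Quaternion => /=; ring. Qed.
Fact add0q : left_id zeroq addq.
Proof. by move=> [? ? ? ?]; congr Quaternion => /=; ring. Qed.
Fact addNq : left_inverse zeroq oppq addq.
Proof. by move=> [? ? ? ?]; congr Quaternion => /=; ring. Qed.

HB.instance Definition _ := GRing.isZmodule.Build H addqA addqC add0q addNq.

Fact mulqA : associative mulq.
Proof. by move=> [? ? ? ?] [? ? ? ?] [? ? ? ?]; congr Quaternion => /=; ring. Qed.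
Fact mul1q : left_id oneq mulq.
Proof. by move=> [? ? ? ?]; congr Quaternion => /=; ring. Qed.
Fact mulq1 : right_id oneq mulq.
Proof. by move=> [? ? ? ?]; congr Quaternion => /=; ring. Qed.
Fact mulqDl : left_distributive mulq addq.
Proof. by move=> [? ? ? ?] [? ? ? ?] [? ? ? ?]; congr Quaternion => /=; ring. Qed.
Fact mulqDr : right_distributive mulq addq.
Proof. by move=> [? ? ? ?] [? ? ? ?] [? ? ? ?]; congr Quaternion => /=; ring. Qed.
Fact oneq_neq0 : oneq != 0.
Proof. by apply/eqP => -[] /eqP; rewrite oner_eq0. Qed.

HB.instance Definition _ := GRing.Zmodule_isNzRing.Build H
  mulqA mul1q mulq1 mulqDl mulqDr oneq_neq0.

Fact scaleqA x y q : scaleq x (scaleq y q) = scaleq (x * y) q.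
Proof. by case: q => ? ? ? ?; congr Quaternion => /=; ring. Qed.
Fact scale1q : left_id 1 scaleq.
Proof. by case=> ? ? ? ?; congr Quaternion => /=; ring. Qed.
Fact scaleqDr : right_distributive scaleq +%R.
Proof. by move=> ? [? ? ? ?] [? ? ? ?]; congr Quaternion => /=; ring. Qed.
Fact scaleqDl q : {morph scaleq^~ q : x y / x + y}.
Proof. by case: q => ? ? ? ? ? ?; congr Quaternion => /=; ring. Qed.

HB.instance Definition _ := GRing.Zmodule_isLmodule.Build R H
  scaleqA scale1q scaleqDr scaleqDl.

Fact scaleqAl x p q : x *: (p * q) = x *: p * q.
Proof. by case: p q => ? ? ? ? [? ? ? ?]; congr Quaternion => /=; ring. Qed.
Fact scaleqAr x p q : x *: (p * q) = p * (x *: q).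
Proof. by case: p q => ? ? ? ? [? ? ? ?]; congr Quaternion => /=; ring. Qed.

HB.instance Definition _ := GRing.Lmodule_isLalgebra.Build R H scaleqAl.
HB.instance Definition _ := GRing.Lalgebra_isAlgebra.Build R H scaleqAr.

Definition dotq p q : R :=
  q0 p * q0 q + q1 p * q1 q + q2 p * q2 q + q3 p * q3 q.

Definition modq q : R := Num.sqrt (dotq q q).

Fact dotqq_ge0 q : 0 <= dotq q q.
Proof. by rewrite /dotq; nra. Qed.

Fact modqD p q : modq (p + q) <= modq p + modq q.
Proof.
have sp := sqr_sqrtr (dotqq_ge0 p).
have sq := sqr_sqrtr (dotqq_ge0 q).
have p0 : 0 <= modq p := sqrtr_ge0 _.
have r0 : 0 <= modq q := sqrtr_ge0 _.
rewrite -(ler_pXn2r (n := 2)) ?nnegrE ?addr_ge0 ?sqrtr_ge0 //.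
rewrite [X in X <= _]sqr_sqrtr ?dotqq_ge0 // sqrrD.
rewrite [X in _ <= X + _ + _]sp [X in _ <= _ + X]sq.
have -> : dotq (p + q) (p + q) = dotq p p + dotq p q *+ 2 + dotq q q.
  by rewrite /dotq /=; ring.
rewrite lerD2r lerD2l lerMn2r /=.
apply: le_trans (ler_norm _) _.
rewrite -(ler_pXn2r (n := 2)) ?nnegrE ?mulr_ge0 ?normr_ge0 //.
rewrite exprMn [X in _ <= X * _]sp [X in _ <= _ * X]sq real_normK ?num_real //.
rewrite -subr_ge0.
case: p q {sp sq p0 r0} => a b c d [a' b' c' d'].
suff -> : dotq (Quaternion a b c d) (Quaternion a b c d) *
    dotq (Quaternion a' b' c' d') (Quaternion a' b' c' d') -
    dotq (Quaternion a b c d) (Quaternion a' b' c' d') ^+ 2 =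
    (a * b' - b * a') ^+ 2 + (a * c' - c * a') ^+ 2 + (a * d' - d * a') ^+ 2 +
    (b * c' - c * b') ^+ 2 + (b * d' - d * b') ^+ 2 + (c * d' - d * c') ^+ 2.
  by rewrite !addr_ge0 ?sqr_ge0.
by rewrite /dotq /=; ring.
Qed.

Fact modqZ x q : modq (x *: q) = `|x| * modq q.
Proof.
have -> : modq (x *: q) = Num.sqrt (x ^+ 2 * dotq q q).
  by congr Num.sqrt; rewrite /dotq /=; ring.
by rewrite sqrtrM ?sqr_ge0 // sqrtr_sqr.
Qed.

Fact modq_eq0 q : modq q = 0 -> q = 0.
Proof.
move=> /eqP; rewrite sqrtr_eq0 /dotq; case: q => a b c d /= le0.
have z (x : R) : x * x <= 0 -> x = 0.
  by move=> xx; apply/eqP; rewrite -sqrf_eq0 expr2 eq_le xx -expr2 sqr_ge0.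
by congr Quaternion; apply: z; nra.
Qed.

(* Equips H with the norm `|q| = modq q and the induced topology. *)
HB.instance Definition _ := Lmodule_isNormed.Build R H modqD modqZ modq_eq0.

End QuaternionAlgebra.

Section Slices.
Variable R : realType.
Local Notation H := (quaternion R).
Local Notation C := R[i].

Definition imag_sphere : set H := [set q | q ^+ 2 = -1].

Definition orthogonal_units (i j : H) : Prop :=
  [/\ imag_sphere i, imag_sphere j & i * j + j * i = 0].

(* The identification of C with the slice C_i, x + 'i y |-> x + i y. *)
Definition slice (i : H) (z : C) : H :=
  (complex.Re z)%:A + complex.Im z *: i.

(* When i and j are orthogonal units, (1, i, j, ij) is an orthonormal basis
   of H; these are the z and w of the decomposition q = z + w j. *)
Definition zpart (i j q : H) : C := Complex (dotq q 1) (dotq q i).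
Definition wpart (i j q : H) : C := Complex (dotq q j) (dotq q (i * j)).

Lemma imag_sphereP (i : H) : imag_sphere i ->
  q0 i = 0 /\ q1 i ^+ 2 + q2 i ^+ 2 + q3 i ^+ 2 = 1.
Proof.
rewrite /imag_sphere /= expr2; case: i => a b c d [/= e0 e1 e2 e3].
have ab : a * b = 0 by lra.
have ac : a * c = 0 by lra.
have ad : a * d = 0 by lra.
have a0 : a = 0.
  apply/eqP; apply/negP => /negP an0; move: ab ac ad => /eqP + /eqP + /eqP.
  rewrite !mulf_eq0 (negPf an0) /= => /eqP b0 /eqP c0 /eqP d0.
  by move: e0; rewrite b0 c0 d0; nra.
by split=> //; move: e0; rewrite a0 !expr2; lra.
Qed.

Lemma orthogonal_unitsP (i j : H) : orthogonal_units i j ->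
  [/\ q0 i = 0, q0 j = 0, q1 i ^+ 2 + q2 i ^+ 2 + q3 i ^+ 2 = 1,
      q1 j ^+ 2 + q2 j ^+ 2 + q3 j ^+ 2 = 1 &
      q1 i * q1 j + q2 i * q2 j + q3 i * q3 j = 0].
Proof.
move=> [/imag_sphereP[i0 i1] /imag_sphereP[j0 j1]] [/= e _ _ _]; split=> //.
by move: e; rewrite i0 j0; lra.
Qed.

Lemma zwpart_decomp (i j q : H) : orthogonal_units i j ->
  q = slice i (zpart i j q) + slice i (wpart i j q) * j.
Proof.
move=> /orthogonal_unitsP[].
case: i j q => [i0 i1 i2 i3] [j0 j1 j2 j3] [a b c d] /= -> -> hi hj hij.
have diag x1 x2 x3 y1 y2 y3 : x1 ^+ 2 + x2 ^+ 2 + x3 ^+ 2 = 1 ->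
    y1 ^+ 2 + y2 ^+ 2 + y3 ^+ 2 = 1 -> x1 * y1 + x2 * y2 + x3 * y3 = 0 ->
    x1 ^+ 2 + y1 ^+ 2 + (x2 * y3 - x3 * y2) ^+ 2 = 1 :> R.
  move=> hx hy hxy; apply/eqP; rewrite -subr_eq0; apply/eqP.
  transitivity ((x1 ^+ 2 + x2 ^+ 2 + x3 ^+ 2 - 1) * (y2 ^+ 2 + y3 ^+ 2) +
    (y1 ^+ 2 + y2 ^+ 2 + y3 ^+ 2 - 1) * (1 - x1 ^+ 2) -
    (x1 * y1 + x2 * y2 + x3 * y3) *
      (x1 * y1 + x2 * y2 + x3 * y3 - (x1 * y1) *+ 2)); first by ring.
  by rewrite hx hy hxy; ring.
have off x1 x2 x3 y1 y2 y3 : x1 ^+ 2 + x2 ^+ 2 + x3 ^+ 2 = 1 ->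
    y1 ^+ 2 + y2 ^+ 2 + y3 ^+ 2 = 1 -> x1 * y1 + x2 * y2 + x3 * y3 = 0 ->
    x1 * x2 + y1 * y2 + (x2 * y3 - x3 * y2) * (x3 * y1 - x1 * y3) = 0 :> R.
  move=> hx hy hxy.
  transitivity ((x1 * y1 + x2 * y2 + x3 * y3) * (x2 * y1 + x1 * y2) -
    (x1 ^+ 2 + x2 ^+ 2 + x3 ^+ 2 - 1) * (y1 * y2) -
    (y1 ^+ 2 + y2 ^+ 2 + y3 ^+ 2 - 1) * (x1 * x2)); first by ring.
  by rewrite hx hy hxy; ring.
have rot (x y z : R) : x + y + z = y + z + x by ring.
have hi' := hi; have hj' := hj; have hij' := hij.
rewrite rot in hi'; rewrite rot in hj'; rewrite rot in hij'.
have hi'' := hi'; have hj'' := hj'; have hij'' := hij'.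
rewrite rot in hi''; rewrite rot in hj''; rewrite rot in hij''.
have d1 := diag _ _ _ _ _ _ hi hj hij.
have d2 := diag _ _ _ _ _ _ hi' hj' hij'.
have d3 := diag _ _ _ _ _ _ hi'' hj'' hij''.
have o12 := off _ _ _ _ _ _ hi hj hij.
have o23 := off _ _ _ _ _ _ hi' hj' hij'.
have o31 := off _ _ _ _ _ _ hi'' hj'' hij''.
have e0 : 0 * 0 - i1 * j1 - i2 * j2 - i3 * j3 = 0 by lra.
rewrite /zpart /wpart /slice /dotq; congr Quaternion => /=; rewrite e0.
- have := congr1 ( *%R (b * (i2 * j3 - i3 * j2) + c * (i3 * j1 - i1 * j3) +
    d * (i1 * j2 - i2 * j1))) hij; lra.
- have := congr1 ( *%R b) d1; have := congr1 ( *%R c) o12.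
  have := congr1 ( *%R d) o31; lra.
- have := congr1 ( *%R c) d2; have := congr1 ( *%R d) o23.
  have := congr1 ( *%R b) o12; lra.
- have := congr1 ( *%R d) d3; have := congr1 ( *%R b) o31.
  have := congr1 ( *%R c) o23; lra.
Qed.

Lemma zwpart_uniq (i j : H) (z w : C) : orthogonal_units i j ->
  zpart i j (slice i z + slice i w * j) = z /\
  wpart i j (slice i z + slice i w * j) = w.
Proof.
move=> /orthogonal_unitsP[].
case: i j z w => [i0 i1 i2 i3] [j0 j1 j2 j3] [x y] [x' y'] /= -> -> hi hj hij.
have hk : (i2 * j3 - i3 * j2) ^+ 2 + (i3 * j1 - i1 * j3) ^+ 2 +
    (i1 * j2 - i2 * j1) ^+ 2 = 1.
  transitivity ((i1 ^+ 2 + i2 ^+ 2 + i3 ^+ 2) * (j1 ^+ 2 + j2 ^+ 2 + j3 ^+ 2) -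
    (i1 * j1 + i2 * j2 + i3 * j3) ^+ 2); first by ring.
  by rewrite hi hj hij; ring.
have e0 : 0 * 0 - i1 * j1 - i2 * j2 - i3 * j3 = 0 by lra.
rewrite /zpart /wpart /slice /dotq /=.
split; congr Complex; rewrite /= ?e0.
- have := congr1 ( *%R y') hij; lra.
- have := congr1 ( *%R y) hi; have := congr1 ( *%R x') hij; lra.
- have := congr1 ( *%R x') hj; have := congr1 ( *%R y) hij; lra.
- have := congr1 ( *%R y') hk; lra.
Qed.

End Slices.

(* An element f(p) = \sum_u p ^ u f_u of the Wiener algebra is represented by
   its coefficient sequence u |-> f_u. *)
Section WienerAlgebra.
Variable R : realType.
Local Notation H := (quaternion R).
Local Notation C := R[i].
Implicit Types f g : int -> H.

(* Used for absolutely summable families only, for which every way of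
   ordering the terms gives the same sum. *)
Definition int_sum (a : int -> H) : H :=
  limn (series (fun n : nat => a (Posz n))) +
  limn (series (fun n : nat => a (Negz n))).

Definition wiener : set (int -> H) :=
  [set f | summable [set: int] (fun u => (`|f u|)%:E)].

Definition wiener_plus : set (int -> H) :=
  [set f | wiener f /\ forall u : int, u < 0 -> f u = 0].

Definition star f g : int -> H :=
  fun u => int_sum (fun k : int => f (u - k) * g k).

Definition star_one : int -> H := fun u => (u == 0)%:R.

Definition wiener_plus_invertible f : Prop :=
  exists g, [/\ wiener_plus g, star f g = star_one & star g f = star_one].

(* The value at p of an element of wiener_plus. *)
Definition wiener_plus_eval f (p : H) : H :=
  limn (series (fun n : nat => p ^+ n * f (Posz n))).

Definition unit_ball : set H := [set p | `|p| < 1].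

Definition cpower_series (c : nat -> C) (z : C) : C :=
  limn (series (fun n : nat => z ^+ n * c n : C^o)).

Definition omega (i j : H) f (z : C) : 'M[C]_2 :=
  let a := cpower_series (fun n : nat => zpart i j (f (Posz n))) in
  let b := cpower_series (fun n : nat => wpart i j (f (Posz n))) in
  \matrix_(k < 2, l < 2)
    if k == 0 then if l == 0 then a z else b z
    else if l == 0 then - (b z^*%C)^*%C else (a z^*%C)^*%C.

End WienerAlgebra.

Arguments unit_ball {R}.

(* Main.v *)
(* [f] is reduced to one complex power series.  Its symmetrization
   [f * f^c], where [f^c] has conjugate coefficients, has real coefficients
   and the value [\det (omega f z)] at [z]; it is multiplicative in [f], so
   the determinant of an invertible [f] never vanishes.  A nonzero row vector
   killed by [omega f z] is the same thing as a nonzero quaternion [u] with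
   [u f(p) = 0] for [p := u^-1 z u], which is how zeros of the determinant
   match zeros of [f].  Conversely, if the determinant has no zero on the closed
   disc then the formal inverse [G] of the symmetrization is absolutely
   summable by a Wiener lemma for power series, and [f^c G] inverts [f]. *)
Require Import Defs.
From HB Require Import structures.
From mathcomp Require Import all_boot all_order all_algebra.
From mathcomp Require Import cyclic separable cyclotomic.
From mathcomp Require Import ring lra zify.
From mathcomp Require Import all_classical all_reals all_analysis.
From mathcomp Require Import complex.
Import Order.TTheory GRing.Theory Num.Theory.
Import numFieldNormedType.Exports.
Set Implicit Arguments.
Unset Strict Implicit.
Unset Printing Implicit Defensive.
Local Open Scope classical_set_scope.
Local Open Scope ring_scope.

(** * Formal power series *)

(** The difficulty sits on the unit circle. The symmetrization [F] is only known to converge for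
    [|z| <= 1], so [1 / F] is holomorphic in the open disc alone, and Cauchy's estimates on the
    circle bound the coefficients of the inverse without making them summable. A polynomial
    truncation of [F] does extend past the circle; this is why the Wiener lemma asks for a lower
    bound that is uniform over the closed disc and over all late truncations, a bound that
    compactness supplies. Algebra and analysis are kept apart: products and inverses are identities
    of formal series, valid without convergence, and the analysis only adds [l^1] bounds. Passing to
    real coefficients serves twice. The estimate needs [(e * b) ^+ N = e ^+ N * b ^+ N], hence
    commutativity; and a real series is central among quaternionic ones, so its inverse can be moved
    past [f] and its conjugate. *)

Record fps (K : Type) := Fps { coef : nat -> K }.

HB.instance Definition _ (K : Type) := gen_eqMixin (fps K).
HB.instance Definition _ (K : Type) := gen_choiceMixin (fps K).

Section FormalPowerSeries.
Variable K : nzRingType.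
Implicit Types a b c : fps K.

Lemma fpsP a b : (forall n, coef a n = coef b n) -> a = b.
Proof.
by case: a b => [a] [b] /= ab; congr Fps; apply/funext.
Qed.

Definition fps_add a b := Fps (fun n => coef a n + coef b n).
Definition fps_opp a := Fps (fun n => - coef a n).
Definition fps_zero : fps K := Fps (fun=> 0).
Definition fps_mul a b := Fps (fun n => \sum_(k < n.+1) coef a k * coef b (n - k)%N).
Definition fps_of_poly (p : {poly K}) := Fps (fun n => p`_n).

Fact fps_addA : associative fps_add.
Proof. by move=> a b c; apply: fpsP => n /=; rewrite addrA. Qed.
Fact fps_addC : commutative fps_add.
Proof. by move=> a b; apply: fpsP => n /=; rewrite addrC. Qed.
Fact fps_add0 : left_id fps_zero fps_add.
Proof. by move=> a; apply: fpsP => n /=; rewrite add0r. Qed.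
Fact fps_addN : left_inverse fps_zero fps_opp fps_add.
Proof. by move=> a; apply: fpsP => n /=; rewrite addNr. Qed.

HB.instance Definition _ :=
  GRing.isZmodule.Build (fps K) fps_addA fps_addC fps_add0 fps_addN.

Definition trunc m a : {poly K} := \poly_(i < m) coef a i.

Lemma coef_trunc m a n : (n < m)%N -> (trunc m a)`_n = coef a n.
Proof. by move=> nm; rewrite coef_poly nm. Qed.

(** Coefficient [n] of a product sees only coefficients up to [n], so series may be replaced by
    truncations; the ring laws are then inherited from polynomials. *)
Lemma fps_mulE m a b (p q : {poly K}) n :
  (forall k, (k < m)%N -> p`_k = coef a k) ->
  (forall k, (k < m)%N -> q`_k = coef b k) ->
  (n < m)%N -> coef (fps_mul a b) n = (p * q)`_n.
Proof.
move=> pa qb nm; rewrite coefM; apply: eq_bigr => k _.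
by rewrite pa ?qb //; have := ltn_ord k; lia.
Qed.

Fact fps_mulA : associative fps_mul.
Proof.
move=> a b c; apply: fpsP => n.
have tE (x : fps K) k : (k < n.+1)%N -> (trunc n.+1 x)`_k = coef x k.
  exact: coef_trunc.
pose A := trunc n.+1 a; pose B := trunc n.+1 b; pose C := trunc n.+1 c.
rewrite (@fps_mulE n.+1 a (fps_mul b c) A (B * C)) //; last 2 first.
- exact: tE.
- by move=> k kn; rewrite (@fps_mulE n.+1 b c B C) //; exact: tE.
rewrite (@fps_mulE n.+1 (fps_mul a b) c (A * B) C) ?mulrA //; last exact: tE.
by move=> k kn; rewrite (@fps_mulE n.+1 a b A B) //; exact: tE.
Qed.

Fact fps_of_polyM p q : fps_of_poly (p * q) = fps_mul (fps_of_poly p) (fps_of_poly q).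
Proof. by apply: fpsP => n /=; rewrite coefM. Qed.

Fact fps_mul1l : left_id (fps_of_poly 1) fps_mul.
Proof.
move=> a; apply: fpsP => n.
rewrite (@fps_mulE n.+1 _ a 1 (trunc n.+1 a)) ?mul1r ?coef_trunc //.
by move=> k; exact: coef_trunc.
Qed.
Fact fps_mul1r : right_id (fps_of_poly 1) fps_mul.
Proof.
move=> a; apply: fpsP => n.
rewrite (@fps_mulE n.+1 a _ (trunc n.+1 a) 1) ?mulr1 ?coef_trunc //.
by move=> k; exact: coef_trunc.
Qed.
Fact fps_mulDl : left_distributive fps_mul fps_add.
Proof.
move=> a b c; apply: fpsP => n /=; rewrite -big_split /=.
by apply: eq_bigr => k _; rewrite mulrDl.
Qed.
Fact fps_mulDr : right_distributive fps_mul fps_add.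
Proof.
move=> a b c; apply: fpsP => n /=; rewrite -big_split /=.
by apply: eq_bigr => k _; rewrite mulrDr.
Qed.
Fact fps_one_neq0 : fps_of_poly 1 != 0.
Proof.
apply/eqP => /(congr1 (fun a => coef a 0%N)) /= /eqP.
by rewrite coefC oner_eq0.
Qed.

HB.instance Definition _ := GRing.Zmodule_isNzRing.Build (fps K)
  fps_mulA fps_mul1l fps_mul1r fps_mulDl fps_mulDr fps_one_neq0.

Lemma coefD_fps a b n : coef (a + b) n = coef a n + coef b n. Proof. by []. Qed.
Lemma coefN_fps a n : coef (- a) n = - coef a n. Proof. by []. Qed.
Lemma coef1_fps n : coef (1 : fps K) n = (n == 0%N)%:R.
Proof. by rewrite /= coefC; case: n. Qed.
Lemma coefM_fps a b n :
  coef (a * b) n = \sum_(k < n.+1) coef a k * coef b (n - k)%N.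
Proof. by []. Qed.
Lemma coef_sum_fps (I : Type) (r : seq I) (P : pred I) (F : I -> fps K) n :
  coef (\sum_(i <- r | P i) F i) n = \sum_(i <- r | P i) coef (F i) n.
Proof. exact: (big_morph (fun a => coef a n)). Qed.

Fact fps_of_poly_additive : additive fps_of_poly.
Proof. by move=> p q; apply: fpsP => n /=; rewrite coefB. Qed.
HB.instance Definition _ :=
  GRing.isZmodMorphism.Build {poly K} (fps K) fps_of_poly fps_of_poly_additive.
Fact fps_of_poly_multiplicative : monoid_morphism fps_of_poly.
Proof. by split=> // p q; exact: fps_of_polyM. Qed.
HB.instance Definition _ :=
  GRing.isMonoidMorphism.Build {poly K} (fps K) fps_of_poly fps_of_poly_multiplicative.

(** Both sides run over the triangle [k + l < m]. The identity underlies the submultiplicativity of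
    the [l^1] norm and the convergence of Cauchy products. *)
Lemma sum_coefM_fps a b m :
  \sum_(n < m) coef (a * b) n =
  \sum_(k < m) coef a k * \sum_(l < m - k) coef b l.
Proof.
elim: m => [|m IH]; first by rewrite !big_ord0.
rewrite big_ord_recr /= IH [in RHS]big_ord_recr /= subSnn big_ord1.
rewrite big_ord_recr /= subnn addrA -big_split /=; congr (_ + _).
apply: eq_bigr => k _; rewrite -mulrDr; congr (_ * _).
by rewrite subSn ?(ltnW (ltn_ord k)) // big_ord_recr.
Qed.

Lemma coef_exp_fps_lt a k n : coef a 0 = 0 -> (n < k)%N -> coef (a ^+ k) n = 0.
Proof.
move=> a0; elim: k n => // k IH n nk.
rewrite exprS coefM_fps big_ord_recl a0 mul0r add0r big1 // => i _.
by rewrite IH ?mulr0 //= /bump; have := ltn_ord i; lia.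
Qed.

End FormalPowerSeries.

Section CommutativeFormalPowerSeries.
Variable K : comNzRingType.
Implicit Types a b : fps K.

Fact fps_mulC : commutative (@fps_mul K).
Proof.
move=> a b; apply: fpsP => n /=; rewrite (reindex_inj rev_ord_inj) /=.
by apply: eq_bigr => k _; rewrite mulrC subSS subKn // -ltnS.
Qed.
HB.instance Definition _ :=
  GRing.PzRing_hasCommutativeMul.Build (fps K) fps_mulC.

(** The substitution [X -> r X]. It serves for evaluation, the value of [a] at [z] being the sum of
    the coefficients of [dilate z a], and for changing the radius of a disc. *)
Definition dilate (r : K) a := Fps (fun n => r ^+ n * coef a n).

Lemma dilateM r a b : dilate r (a * b) = dilate r a * dilate r b.
Proof.
apply: fpsP => n /=; rewrite mulr_sumr; apply: eq_bigr => k _.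
rewrite mulrACA -exprD subnKC //.
by have := ltn_ord k; rewrite ltnS.
Qed.

Lemma dilate1 r : dilate r 1 = 1.
Proof.
by apply: fpsP => n; rewrite coef1_fps /= coefC; case: n => [|n] /=; rewrite ?expr0 ?mulr1 ?mulr0.
Qed.

Lemma dilateX r a k : dilate r (a ^+ k) = dilate r a ^+ k.
Proof.
by elim: k => [|k IH]; rewrite ?expr0 ?dilate1 // !exprS dilateM IH.
Qed.

Lemma sum_dilate z a m : \sum_(n < m) coef (dilate z a) n = (trunc m a).[z].
Proof.
rewrite horner_poly; apply: eq_bigr => n _; exact: mulrC.
Qed.

(* [1 / (1 - u) = \sum_k u ^+ k], of which only finitely many terms
   contribute to a given coefficient because [coef u 0 = 0]. *)
Lemma fps_inv_exists a : coef a 0 = 1 -> exists b, a * b = 1.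
Proof.
move=> a0; pose u := 1 - a.
have u0 : coef u 0 = 0 by rewrite /u coefD_fps coefN_fps a0 coef1_fps subrr.
exists (Fps (fun n => coef (\sum_(k < n.+1) u ^+ k) n)); apply: fpsP => n.
have -> : a = 1 - u by rewrite /u subKr.
transitivity (coef ((1 - u) * \sum_(k < n.+1) u ^+ k) n).
  rewrite !coefM_fps; apply: eq_bigr => i _ /=; congr (_ * _).
  rewrite !coef_sum_fps (big_ord_widen n.+1 (fun k => coef (u ^+ k) (n - i)%N)) ?ltnS ?leq_subr //.
  rewrite [RHS](bigID (fun k : 'I_n.+1 => (k < (n - i).+1)%N)) /=.
  rewrite [X in _ + X]big1 ?addr0 // => k.
  by rewrite -leqNgt => ik; rewrite coef_exp_fps_lt.
rewrite -[X in coef X n]opprK -mulNr opprB -subrX1 opprB coefD_fps coefN_fps.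
by rewrite coef_exp_fps_lt // subr0.
Qed.

End CommutativeFormalPowerSeries.

Lemma fps_inv_exists_field (K : fieldType) (a : fps K) :
  coef a 0 != 0 -> exists b, a * b = 1.
Proof.
move=> a0; have [|b ab] := @fps_inv_exists _ (fps_of_poly (coef a 0)^-1%:P * a).
  by rewrite coefM_fps big_ord1 /= coefC /= mulVf.
by exists (fps_of_poly (coef a 0)^-1%:P * b); rewrite mulrCA mulrA.
Qed.

Section MapFormalPowerSeries.
Variables (K L : nzRingType) (h : {rmorphism K -> L}).

Definition map_fps (a : fps K) : fps L := Fps (fun n => h (coef a n)).

Fact map_fps_additive : additive map_fps.
Proof. by move=> a b; apply: fpsP => n /=; rewrite rmorphB. Qed.
HB.instance Definition _ :=
  GRing.isZmodMorphism.Build (fps K) (fps L) map_fps map_fps_additive.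
Fact map_fps_multiplicative : monoid_morphism map_fps.
Proof.
split; first by apply: fpsP => n; rewrite /= !coefC; case: n => [|n] /=; rewrite ?rmorph1 ?rmorph0.
move=> a b; apply: fpsP => n /=; rewrite rmorph_sum /=.
by apply: eq_bigr => k _; rewrite rmorphM.
Qed.
HB.instance Definition _ :=
  GRing.isMonoidMorphism.Build (fps K) (fps L) map_fps map_fps_multiplicative.

End MapFormalPowerSeries.

(** * Absolute summability *)

Section RealSums.
Variable R : realType.
Implicit Types a s : nat -> R.

Lemma sum_tail_le a M : (forall n, 0 <= a n) ->
  (forall m, \sum_(k < m) a k <= M) ->
  forall e, 0 < e -> exists n0, forall m, \sum_(n0 <= k < m) a k <= e.
Proof.
move=> a0 aM e e0; pose E := [set \sum_(k < m) a k | m in [set: nat]].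
have hE : has_sup E.
  by split; [exists (\sum_(k < 0) a k), 0%N | exists M => _ [m _ <-]].
have [_ [n0 _ <-] hn0] := sup_adherent e0 hE; exists n0 => m.
have [mn|nm] := leqP m n0; first by rewrite big_geq // ltW.
have : \sum_(k < m) a k <= sup E by apply: ub_le_sup; [case: hE | exists m].
rewrite -(big_mkord xpredT) (@big_cat_nat _ _ _ n0) ?(ltnW nm) //= big_mkord.
by lra.
Qed.

(** Cut the sum at a fixed [n2]: below it [n - k] is large and [s] is small, above it [s] is bounded
    and the tail of [a] is small. *)
Lemma convolution_cvg0 a s M B : (forall n, 0 <= a n) ->
  (forall m, \sum_(k < m) a k <= M) -> (forall n, s n <= B) ->
  (forall e, 0 < e -> exists n0, forall n, (n0 <= n)%N -> s n <= e) ->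
  forall e, 0 < e -> exists n0, forall n, (n0 <= n)%N ->
    \sum_(k < n) a k * s (n - k)%N <= e.
Proof.
move=> a0 aM sB s0 e e0.
have M0 : 0 <= M by apply: le_trans (aM 0%N); rewrite big_ord0.
have B0 : 0 <= `|B| + 1 by rewrite addr_ge0.
have [n1 h1] := s0 (e / 2 / (M + 1)) ltac:(by rewrite !divr_gt0 ?ltr_wpDl).
have [n2 h2] := sum_tail_le a0 aM (e := e / 2 / (`|B| + 1))
  ltac:(by rewrite !divr_gt0 ?ltr_wpDl).
exists (n1 + n2)%N => n hn.
rewrite -(big_mkord xpredT (fun k => a k * s (n - k)%N)) (@big_cat_nat _ _ _ n2) //=; last by lia.
rewrite (splitr e); apply: lerD.
  apply: (@le_trans _ _ (\sum_(k < n2) a k * (e / 2 / (M + 1)))).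
    rewrite big_mkord; apply: ler_sum => k _; apply: ler_wpM2l => //.
    by apply: h1; have := ltn_ord k; lia.
  rewrite -mulr_suml mulrCA ler_piMr ?divr_ge0 ?(ltW e0) //.
  by rewrite ler_pdivrMr ?mul1r ?ltr_wpDl //; have := aM n2; lra.
apply: (@le_trans _ _ (\sum_(n2 <= k < n) a k * (`|B| + 1))).
  apply: ler_sum => k _; apply: ler_wpM2l => //.
  by apply: le_trans (sB _) _; apply: le_trans (ler_norm B) _; rewrite lerDl.
by rewrite -mulr_suml -ler_pdivlMr ?h2 ?ltr_wpDl.
Qed.

End RealSums.

(** Lets the complex modulus and the quaternionic norm share one development. The values are in [R],
    whereas [|z|] for a complex [z] is itself an element of [R[i]]. *)
Record absval (R : realType) (K : nzRingType) := Absval {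
  abv :> K -> R;
  abv_ge0 : forall x, 0 <= abv x;
  abv0 : abv 0 = 0;
  abv_eq0 : forall x, abv x = 0 -> x = 0;
  abv1 : abv 1 = 1;
  abvN : forall x, abv (- x) = abv x;
  abvM : forall x y, abv (x * y) = abv x * abv y;
  abvD : forall x y, abv (x + y) <= abv x + abv y }.

Section AbsoluteSummability.
Variables (R : realType) (K : nzRingType) (N : absval R K).
Implicit Types (a b : fps K) (x y l : K) (s t : nat -> K).

Lemma abvB x y : N (x - y) <= N x + N y.
Proof. by rewrite -[N y]abvN abvD. Qed.

Lemma abvBC x y : N (x - y) = N (y - x).
Proof. by rewrite -abvN opprB. Qed.

Lemma abv_sum (I : Type) (r : seq I) (P : pred I) (F : I -> K) :
  N (\sum_(i <- r | P i) F i) <= \sum_(i <- r | P i) N (F i).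
Proof.
elim/big_ind2 : _ => [|x u y v xu yv|//]; first by rewrite abv0.
by apply: le_trans (abvD _ _ _) _; exact: lerD.
Qed.

Lemma abvX x n : N (x ^+ n) = N x ^+ n.
Proof. by elim: n => [|n IH]; rewrite ?expr0 ?abv1 // !exprS abvM IH. Qed.

Definition converges s l :=
  forall e : R, 0 < e -> exists n0, forall n, (n0 <= n)%N -> N (s n - l) <= e.

(** The [l^1] norm expressed through partial sums, so that estimates form no limit and ask no
    completeness of [K]. *)
Definition norm_le a (M : R) := forall m, \sum_(k < m) N (coef a k) <= M.

Definition psum a m := \sum_(k < m) coef a k.

Lemma convergesD s t l l' : converges s l -> converges t l' ->
  converges (fun n => s n + t n) (l + l').
Proof.
move=> sl tl e e0; have e2 : 0 < e / 2 by rewrite divr_gt0.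
have [n1 h1] := sl _ e2; have [n2 h2] := tl _ e2.
exists (n1 + n2)%N => n hn; rewrite opprD addrACA (splitr e).
by apply: le_trans (abvD _ _ _) _; apply: lerD; [apply: h1|apply: h2]; lia.
Qed.

Lemma convergesMl x s l : converges s l -> converges (fun n => x * s n) (x * l).
Proof.
move=> sl e e0; have [|n0 h] := sl (e / (N x + 1)).
  by rewrite divr_gt0 // ltr_wpDl ?abv_ge0.
exists n0 => n /h; rewrite -mulrBr abvM ler_pdivlMr ?ltr_wpDl ?abv_ge0 //.
by have := abv_ge0 N (s n - l); nra.
Qed.

Lemma convergesMr x s l : converges s l -> converges (fun n => s n * x) (l * x).
Proof.
move=> sl e e0; have [|n0 h] := sl (e / (N x + 1)).
  by rewrite divr_gt0 // ltr_wpDl ?abv_ge0.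
exists n0 => n /h; rewrite -mulrBl abvM ler_pdivlMr ?ltr_wpDl ?abv_ge0 //.
by have := abv_ge0 N (s n - l); nra.
Qed.

Lemma converges_ext s t l : s =1 t -> converges s l -> converges t l.
Proof. by move=> /funext ->. Qed.

Lemma converges_unique s l l' : converges s l -> converges s l' -> l = l'.
Proof.
move=> sl sl'; apply/eqP; rewrite -subr_eq0; apply/eqP/(abv_eq0 (a := N)).
apply/eqP; rewrite eq_le abv_ge0 andbT; apply/ler_addgt0Pr => e e0; rewrite add0r.
have e2 : 0 < e / 2 by rewrite divr_gt0.
have [n1 h1] := sl _ e2; have [n2 h2] := sl' _ e2.
have -> : l - l' = (s (n1 + n2)%N - l') - (s (n1 + n2)%N - l).
  by rewrite opprB [RHS]addrC addrA subrK.
apply: le_trans (abvB _ _) _; rewrite (splitr e).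
by apply: lerD; [apply: h2|apply: h1]; lia.
Qed.

Lemma norm_le_ge0 a M : norm_le a M -> 0 <= M.
Proof. by move=> /(_ 0%N); rewrite big_ord0. Qed.

Lemma norm_leD a b A B : norm_le a A -> norm_le b B -> norm_le (a + b) (A + B).
Proof.
move=> aA bB m; apply: le_trans (lerD (aA m) (bB m)).
by rewrite -big_split /=; apply: ler_sum => k _; exact: abvD.
Qed.

Lemma psumM_le a b m :
  \sum_(n < m) N (coef (a * b) n) <=
  \sum_(k < m) N (coef a k) * \sum_(l < m - k) N (coef b l).
Proof.
rewrite -(sum_coefM_fps (Fps (N \o coef a)) (Fps (N \o coef b))).
apply: ler_sum => n _; rewrite !coefM_fps; apply: le_trans (abv_sum _ _ _) _.
by apply: ler_sum => k _ /=; rewrite abvM.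
Qed.

Lemma norm_leM a b A B : norm_le a A -> norm_le b B -> norm_le (a * b) (A * B).
Proof.
move=> aA bB m; apply: le_trans (psumM_le _ _ _) _.
apply: le_trans (ler_wpM2r (norm_le_ge0 bB) (aA m)); rewrite mulr_suml.
by apply: ler_sum => k _; apply: ler_wpM2l; [exact: abv_ge0|exact: bB].
Qed.

Lemma norm_le1 : norm_le 1 1.
Proof.
case=> [|m]; first by rewrite big_ord0.
rewrite big_ord_recl big1 => [|k _]; rewrite coef1_fps ?abv1 ?addr0 //.
exact: abv0.
Qed.

Lemma norm_leX a A n : norm_le a A -> norm_le (a ^+ n) (A ^+ n).
Proof.
by move=> aA; elim: n => [|n IH]; [exact: norm_le1|rewrite !exprS; exact: norm_leM].
Qed.

Lemma norm_le_poly (p : {poly K}) :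
  norm_le (fps_of_poly p) (\sum_(i < size p) N p`_i).
Proof.
move=> m; have [mp|pm] := leqP m (size p).
  rewrite (big_ord_widen _ (fun k => N p`_k) mp) /= [leRHS](bigID (fun i : 'I__ => (i < m)%N)) /=.
  by rewrite lerDl sumr_ge0 // => *; exact: abv_ge0.
rewrite (big_ord_widen _ (fun k => N p`_k) (ltnW pm)) /= [leLHS](bigID (fun i : 'I__ => (i < size p)%N)) /=.
rewrite [X in _ + X]big1 ?addr0 // => i.
by rewrite -leqNgt => pi; rewrite nth_default ?abv0.
Qed.

(** Mertens' theorem: the error is the convolution of [a] with the null sequence [psum b n - lb],
    plus [(psum a n - la) * lb]. *)
Lemma psum_cauchy_product a b A la lb : norm_le a A ->
  converges (psum a) la -> converges (psum b) lb ->
  converges (psum (a * b)) (la * lb).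
Proof.
move=> aA ala blb; have [B hB] : exists B, forall n, N (psum b n - lb) <= B.
  have [n0 h] := blb 1 ltr01.
  exists (1 + \sum_(k < n0) N (psum b k - lb)) => n.
  have S0 (P : pred 'I_n0) : 0 <= \sum_(k < n0 | P k) N (psum b k - lb).
    by apply: sumr_ge0 => *; exact: abv_ge0.
  have [/h|nn0] := leqP n0 n; first by have := S0 xpredT; lra.
  rewrite (bigD1 (Ordinal nn0)) //=.
  by have := S0 (fun i => i != Ordinal nn0); lra.
have c0 := convolution_cvg0 (fun n => abv_ge0 N (coef a n)) aA hB blb.
have c1 := convergesMr lb ala.
move=> e e0; have e2 : 0 < e / 2 by rewrite divr_gt0.
have [n1 h1] := c0 _ e2; have [n2 h2] := c1 _ e2.
exists (n1 + n2)%N => n hn.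
have -> : psum (a * b) n - la * lb =
    \sum_(k < n) coef a k * (psum b (n - k)%N - lb) + (psum a n * lb - la * lb).
  rewrite /psum sum_coefM_fps addrA; congr (_ - _).
  rewrite mulr_suml -big_split /=; apply: eq_bigr => k _.
  by rewrite mulrBr subrK.
apply: le_trans (abvD _ _ _) _; rewrite (splitr e); apply: lerD; last by apply: h2; lia.
apply: le_trans (h1 n ltac:(lia)); apply: le_trans (abv_sum _ _ _) _.
by apply: ler_sum => k _; rewrite abvM.
Qed.

Lemma psum_tail a A : norm_le a A -> forall e : R, 0 < e -> exists n0, forall n m,
  (n0 <= n)%N -> \sum_(n <= k < m) N (coef a k) <= e.
Proof.
move=> aA e e0; have [n0 h] := sum_tail_le (fun n => abv_ge0 N (coef a n)) aA e0.
exists n0 => n m n0n; have [mn|nm] := leqP m n; first by rewrite big_geq // ltW.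
apply: le_trans (h m); rewrite (@big_cat_nat _ _ _ n n0 m) ?(ltnW nm) //= lerDr.
by apply: sumr_ge0 => *; exact: abv_ge0.
Qed.

End AbsoluteSummability.

(** * Complex power series *)

Section ComplexModulus.
Variable R : realType.
Local Notation C := R[i].
Implicit Types (z w : C) (a b : fps C) (p : {poly C}).

Lemma normcE z : Normc.normc z = Num.sqrt (complex.Re z ^+ 2 + complex.Im z ^+ 2).
Proof. by case: z. Qed.

Fact cabs_ge0 z : 0 <= Normc.normc z.
Proof. by rewrite normcE sqrtr_ge0. Qed.
Fact cabsN z : Normc.normc (- z) = Normc.normc z.
Proof. by rewrite !normcE !raddfN /= !sqrrN. Qed.
Fact cabsD z w : Normc.normc (z + w) <= Normc.normc z + Normc.normc w.
Proof. exact: le_normcD. Qed.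

(* Opaque, so that simplification does not unfold it into [Normc.normc]. *)
Fact cabs_sig : {N : absval R C | forall z, N z = Normc.normc z}.
Proof.
by exists (Absval cabs_ge0 (Normc.normc0 R) (@Normc.eq0_normc R)
  (Normc.normc1 R) cabsN (@Normc.normcM R) cabsD).
Qed.

Definition cabs : absval R C := sval cabs_sig.

Lemma cabsE z : cabs z = Num.sqrt (complex.Re z ^+ 2 + complex.Im z ^+ 2).
Proof. by rewrite -normcE; exact: (svalP cabs_sig). Qed.

Lemma norm_cabs z : `|z| = (cabs z)%:C%C.
Proof. by rewrite normc_def cabsE. Qed.

Lemma cabs_real (x : R) : cabs x%:C%C = `|x|.
Proof. by rewrite cabsE /= expr0n addr0 sqrtr_sqr. Qed.

Lemma cabsJ z : cabs z^*%C = cabs z.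
Proof. by rewrite !cabsE; case: z => x y /=; rewrite sqrrN. Qed.

Lemma cabsV z : cabs z^-1 = (cabs z)^-1.
Proof. by have := Normc.normcV z; rewrite !normcE -!cabsE. Qed.

Lemma cabs_gt0 z : z != 0 -> 0 < cabs z.
Proof.
by move=> z0; rewrite lt_def abv_ge0 andbT; apply: contra z0 => /eqP/abv_eq0 ->.
Qed.

Lemma Re_le_cabs z : `|complex.Re z| <= cabs z.
Proof. by rewrite cabsE -sqrtr_sqr ler_wsqrtr // lerDl sqr_ge0. Qed.

Lemma Im_le_cabs z : `|complex.Im z| <= cabs z.
Proof. by rewrite cabsE -sqrtr_sqr ler_wsqrtr // lerDr sqr_ge0. Qed.

Lemma cabs_le_ReIm z : cabs z <= `|complex.Re z| + `|complex.Im z|.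
Proof.
rewrite cabsE -[leRHS]ger0_norm ?addr_ge0 // -sqrtr_sqr ler_wsqrtr //.
rewrite sqrrD !real_normK ?num_real //.
by rewrite -addrA lerD2l lerDr mulrn_wge0 ?mulr_ge0.
Qed.

Lemma real_series_converges (u : nat -> R) M :
  (forall m, \sum_(k < m) `|u k| <= M) ->
  exists l, forall e, 0 < e -> exists n0, forall n, (n0 <= n)%N ->
    `|\sum_(k < n) u k - l| <= e.
Proof.
move=> uM; have : cvgn (series u).
  apply: normed_cvg; apply: nondecreasing_is_cvgn.
    by apply: nondecreasing_series => n _ _; exact: normr_ge0.
  exists M => _ [n _ <-]; rewrite /normed_series_of seriesEord; exact: uM.
move=> /cvgrPdist_le h; exists (limn (series u)) => e /h[n0 _ {}h].
by exists n0 => n /h; rewrite distrC /series /= big_mkord.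
Qed.

Lemma converges_ReIm (s : nat -> C) x y :
  (forall e, 0 < e -> exists n0, forall n, (n0 <= n)%N -> `|complex.Re (s n) - x| <= e) ->
  (forall e, 0 < e -> exists n0, forall n, (n0 <= n)%N -> `|complex.Im (s n) - y| <= e) ->
  converges cabs s (Complex x y).
Proof.
move=> hx hy e e0; have e2 : 0 < e / 2 by rewrite divr_gt0.
have [n1 h1] := hx _ e2; have [n2 h2] := hy _ e2.
exists (n1 + n2)%N => n hn; apply: le_trans (cabs_le_ReIm _) _.
by rewrite !raddfB /= (splitr e); apply: lerD; [apply: h1|apply: h2]; lia.
Qed.

Lemma psum_is_cvg a A : norm_le cabs a A -> exists l, converges cabs (psum a) l.
Proof.
move=> aA.
have [|x hx] := @real_series_converges (fun n => complex.Re (coef a n)) A.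
  by move=> m; apply: le_trans (aA m); apply: ler_sum => k _; exact: Re_le_cabs.
have [|y hy] := @real_series_converges (fun n => complex.Im (coef a n)) A.
  by move=> m; apply: le_trans (aA m); apply: ler_sum => k _; exact: Im_le_cabs.
exists (Complex x y); apply: converges_ReIm => e e0.
  by have [n0 h] := hx _ e0; exists n0 => n /h; rewrite /psum raddf_sum.
by have [n0 h] := hy _ e0; exists n0 => n /h; rewrite /psum raddf_sum.
Qed.

Lemma norm_le_dilate z a A : cabs z <= 1 -> norm_le cabs a A ->
  norm_le cabs (dilate z a) A.
Proof.
move=> z1 aA m; apply: le_trans (aA m); apply: ler_sum => k _ /=.
rewrite [leLHS](abvM cabs) abvX ler_piMl ?abv_ge0 //.
by rewrite exprn_ile1 ?abv_ge0.
Qed.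

Lemma psum_dilateE z a m : psum (dilate z a) m = (trunc m a).[z].
Proof. exact: sum_dilate. Qed.

Lemma psum_dilate_poly z p m : (size p <= m)%N ->
  psum (dilate z (fps_of_poly p)) m = p.[z].
Proof.
move=> pm; rewrite psum_dilateE; congr (_.[z]); apply/polyP => k.
by rewrite coef_poly; case: ltnP => // mk; rewrite nth_default // (leq_trans pm).
Qed.

Lemma converges_poly z p : converges cabs (psum (dilate z (fps_of_poly p))) p.[z].
Proof.
by move=> e e0; exists (size p) => n pn; rewrite psum_dilate_poly // subrr abv0 ltW.
Qed.

Lemma sum_geometric (r : R) m : 0 <= r -> r < 1 -> \sum_(k < m) r ^+ k <= (1 - r)^-1.
Proof.
move=> r0 r1; rewrite -[leRHS]mul1r ler_pdivlMr ?subr_gt0 //.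
by rewrite mulrC -opprB mulNr -subrX1 opprB lerBlDr lerDl exprn_ge0.
Qed.

(* The inverse of [1 - z / x] is the geometric series [\sum_n z ^+ n / x ^+ n]. *)
Lemma linear_inv_summable z : 1 < cabs z ->
  exists b B, fps_of_poly ('X - z%:P) * b = 1 /\ norm_le cabs b B.
Proof.
move=> z1; have z0 : z != 0 by apply/eqP => z0; rewrite z0 abv0 ltr10 in z1.
exists (Fps (fun n => - z^-1 ^+ n.+1)), (1 - (cabs z)^-1)^-1; split.
  apply: fpsP => n; rewrite coef1_fps coefM_fps.
  case: n => [|n]; first by rewrite big_ord1 /= coefB coefX coefC /= sub0r mulrNN expr1 mulfV.
  rewrite 2!big_ord_recl big1 => [|k _]; last by rewrite /= coefB coefX coefC /= subr0 mul0r.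
  rewrite /= !coefB !coefX !coefC /= !subSS !subn0 sub0r subr0 mulrNN.
  by rewrite mul1r addr0 [_ ^+ n.+2]exprS mulrA mulfV // mul1r subrr.
move=> m; apply: le_trans (sum_geometric m _ _); rewrite ?invr_ge0 ?abv_ge0 //; last first.
  by rewrite invf_lt1 // (lt_trans ltr01).
apply: ler_sum => k _ /=; rewrite [leLHS](abvN cabs) abvX cabsV exprS ler_piMl //.
  by rewrite exprn_ge0 // invr_ge0 abv_ge0.
by rewrite invf_le1 ?(lt_trans ltr01) // ltW.
Qed.

(** Over the algebraically closed [C] the polynomial splits into factors [X - z] with [|z| > 1];
    their geometric inverses are multiplied together. *)
Lemma poly_inv_summable p : (forall z, cabs z <= 1 -> p.[z] != 0) ->
  exists b B, fps_of_poly p * b = 1 /\ norm_le cabs b B.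
Proof.
move=> p0; have [rs prs] := closed_field_poly_normal p.
have lc0 : lead_coef p != 0.
  rewrite lead_coef_eq0; apply/eqP => pE; have := p0 0.
  by rewrite abv0 ler01 pE horner0 eqxx => /(_ isT).
have rs1 z : z \in rs -> 1 < cabs z.
  move=> zrs; rewrite ltNge; apply/negP => /p0/negP; apply.
  by rewrite prs hornerZ mulf_eq0 [X in _ || X](_ : _ = true) ?orbT // -rootE root_prod_XsubC.
have [b [B [pb bB]]] : exists b B,
    fps_of_poly (\prod_(z <- rs) ('X - z%:P)) * b = 1 /\ norm_le cabs b B.
  elim: rs rs1 {prs} => [|z rs IH] h.
    by exists 1, 1; rewrite big_nil rmorph1 mulr1; split=> //; exact: norm_le1.
  have [|b [B [pb bB]]] := IH; first by move=> x xrs; apply: h; rewrite inE xrs orbT.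
  have [|c [D [zc cD]]] := @linear_inv_summable z; first by apply: h; rewrite inE eqxx.
  exists (c * b), (D * B); split; last exact: norm_leM.
  by rewrite big_cons rmorphM /= mulrACA zc pb mulr1.
move: (lead_coef p) lc0 prs => c c0 prs.
exists (fps_of_poly c^-1%:P * b), (cabs c^-1 * B); split.
  rewrite prs -mul_polyC rmorphM /= mulrACA pb mulr1 -rmorphM /= -polyCM.
  by rewrite mulfV // rmorph1.
apply: norm_leM => // m; apply: le_trans (norm_le_poly _ _ m) _.
by rewrite size_polyC; case: eqP => [->|_] /=; rewrite ?big_ord0 ?big_ord1 ?coefC ?abv_ge0.
Qed.

(** In characteristic 0 the polynomial [X^n - 1] is separable, so it has [n] distinct roots, and [n]
    distinct [n]-th roots of unity in a field include a primitive one. *)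
Lemma prim_root_exists n : (0 < n)%N -> exists z : C, n.-primitive_root z.
Proof.
move=> n0; have n0C : n%:R != 0 :> C by rewrite pnatr_eq0 -lt0n.
have [rs prs] := closed_field_poly_normal ('X^n - 1 : {poly C}).
rewrite lead_coefXnsubC // scale1r in prs.
have rsn : size rs = n.
  by have := size_XnsubC (1 : C) n0; rewrite prs size_prod_XsubC => -[].
have /hasP[z _ hz] : has n.-primitive_root rs.
  apply: has_prim_root => //; last by rewrite rsn.
    by apply/allP => z; rewrite -root_prod_XsubC -prs.
  by rewrite -separable_prod_XsubC -prs separable_Xn_sub_1.
by exists z.
Qed.

(* The coefficient is the mean of [w^-k p(w)] over the [m]-th roots of unity. *)
Lemma coef_le_sup p m (B : R) k : (0 < m)%N -> (size p <= m)%N ->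
  (forall z, cabs z = 1 -> cabs p.[z] <= B) -> cabs p`_k <= B.
Proof.
move=> m0 pm pB; have [z hz] := prim_root_exists m0.
have B0 : 0 <= B by apply: le_trans (pB 1 (abv1 _)); exact: abv_ge0.
have [mk|km] := leqP m k; first by rewrite nth_default ?abv0 // (leq_trans pm).
have z1 i : cabs (z ^+ i) = 1.
  rewrite abvX; apply/eqP; suff -> : cabs z = 1 by rewrite expr1n.
  by apply/eqP; rewrite -(pexpr_eq1 m0) ?abv_ge0 // -abvX (prim_expr_order hz) abv1.
have sumz (l : 'I_m) : \sum_(i < m) z ^+ i ^+ l * z ^+ i ^- k = (l == k :> nat)%:R * m%:R.
  case: eqP => [->|/eqP lk].
    rewrite mul1r (eq_bigr (fun=> 1)) ?sumr_const ?card_ord // => i _.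
    by rewrite mulfV // -exprM expf_neq0 // (prim_root_eq0 hz) -lt0n.
  (* For distinct [l, k < m] this is an [m]-th root of unity other than 1, so its geometric sum
     vanishes. *)
  pose x := z ^+ l * z ^- k.
  have x1 : x - 1 != 0.
    rewrite subr_eq0 /x; apply: contra lk => /eqP xE; have : z ^+ l = z ^+ k.
      by rewrite -[LHS](@mulfVK _ (z ^+ k)) ?xE ?mul1r // expf_neq0 // (prim_root_eq0 hz) -lt0n.
    by move/eqP; rewrite (eq_prim_root_expr hz) !modn_small.
  rewrite mul0r (eq_bigr (fun i : 'I_m => x ^+ i)); last first.
    by move=> i _; rewrite /x exprMn exprVn -!exprM mulnC [(i * k)%N]mulnC.
  apply: (mulfI x1); rewrite mulr0 -subrX1 /x exprMn exprVn -!exprM.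
  by rewrite mulnC [(k * m)%N]mulnC !exprM (prim_expr_order hz) !expr1n mulfV ?oner_neq0 // subrr.
suff : cabs (p`_k * m%:R) <= B * m%:R.
  rewrite abvM (_ : m%:R = m%:R%:C%C); last by rewrite rmorph_nat.
  by rewrite cabs_real ger0_norm // ler_pM2r // ltr0n.
have -> : p`_k * m%:R = \sum_(i < m) p.[z ^+ i] * z ^+ i ^- k.
  transitivity (\sum_(l < m) p`_l * \sum_(i < m) z ^+ i ^+ l * z ^+ i ^- k).
    rewrite (bigD1 (Ordinal km)) // sumz eqxx mul1r /= big1 ?addr0 // => l lk.
    by rewrite sumz (_ : _ == _ = false) ?mul0r ?mulr0 //; apply/negbTE.
  under eq_bigr do rewrite mulr_sumr; rewrite exchange_big /=.
  by apply: eq_bigr => i _; rewrite (horner_coef_wide _ pm) mulr_suml;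
    apply: eq_bigr => l _; rewrite mulrA.
apply: le_trans (abv_sum _ _ _ _) _; rewrite -[m in leRHS]card_ord mulr_natr -sumr_const.
apply: ler_sum => i _; rewrite abvM -exprVn abvX cabsV z1 invr1 expr1n mulr1.
exact: pB.
Qed.

End ComplexModulus.
Arguments cabs {R}.

(** * Wiener's lemma *)

Section WienerLemma.
Variable R : realType.
Local Notation C := R[i].

Implicit Types (z w : C) (a b F G : fps C) (p : {poly C}).

Lemma trunc_tail_le a z n m (e : R) : (n <= m)%N -> cabs z <= 1 ->
  \sum_(n <= k < m) cabs (coef a k) <= e ->
  cabs ((trunc m a).[z] - (trunc n a).[z]) <= e.
Proof.
move=> nm z1 he; apply: le_trans he.
rewrite !horner_poly -!(big_mkord xpredT (fun k => coef a k * z ^+ k)).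
rewrite (@big_cat_nat _ _ _ n 0%N m) //= addrAC subrr add0r.
apply: le_trans (abv_sum _ _ _ _) _; apply: ler_sum => k _.
by rewrite abvM abvX ler_piMr ?abv_ge0 // exprn_ile1 // abv_ge0.
Qed.

(** A Cauchy estimate on the unit circle, where [b ^+ N] takes the value [p(z)^-N]. The gain over
    the obvious bound [B ^+ N] is that only [d] enters; [B] merely makes the truncations converge
    uniformly. *)
Lemma coef_inv_exp_le p b (B d : R) N k : 0 < d ->
  (forall z, cabs z <= 1 -> d <= cabs p.[z]) ->
  fps_of_poly p * b = 1 -> norm_le cabs b B ->
  cabs (coef (b ^+ N) k) <= (d ^- N).
Proof.
move=> d0 pd pb bB; have qB := norm_leX N bB; set q := b ^+ N in qB *.
apply/ler_addgt0Pr => e e0; have e2 : 0 < e / 2 by rewrite divr_gt0.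
have [n0 tail] := psum_tail qB e2; pose m := (n0 + k.+1)%N.
have <- : (trunc m q)`_k = coef q k by apply: coef_trunc; rewrite /m; lia.
apply: (@coef_le_sup _ _ m); [by rewrite /m addnS|exact: size_poly|move=> z z1].
have zle : cabs z <= 1 by rewrite z1.
have [l hl] := psum_is_cvg (norm_le_dilate zle qB).
have pl : p.[z] ^+ N * l = 1.
  rewrite -horner_exp.
  have := psum_cauchy_product (norm_le_dilate zle (norm_le_poly cabs (p ^+ N)))
    (converges_poly z (p ^+ N)) hl.
  rewrite -dilateM rmorphXn -exprMn pb expr1n dilate1 => h.
  apply: (converges_unique h); move=> x x0; exists 1%N => -[//|n _].
  rewrite /psum big_ord_recl big1 => [|i _]; last by rewrite coef1_fps.
  by rewrite coef1_fps addr0 subrr abv0 ltW.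
have lE : cabs l <= d ^- N.
  have := congr1 cabs pl; rewrite abvM abvX abv1 => /(canRL (mulKf _)) ->.
    rewrite mulr1 lef_pV2 ?posrE ?exprn_gt0 ?(lt_le_trans d0) ?pd //.
    by rewrite lerXn2r ?nnegrE ?(ltW d0) ?abv_ge0 ?pd.
  by rewrite expf_neq0 // gt_eqF // (lt_le_trans d0) ?pd.
(* The truncation at [m] is compared with the value [l] through a longer truncation at [n]; each of
   the two gaps costs [e / 2]. *)
have [n1 hn1] := hl _ e2; pose n := (n1 + m)%N.
have := hn1 n ltac:(rewrite /n; lia); rewrite psum_dilateE => h1.
have h2 := trunc_tail_le (a := q) (n := m) (m := n) ltac:(rewrite /n; lia) zle
  (tail m n ltac:(rewrite /m; lia)).
have := abvD cabs l ((trunc n q).[z] - l); rewrite addrC subrK => h3.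
have := abvB cabs (trunc n q).[z] ((trunc n q).[z] - (trunc m q).[z]).
by rewrite opprB addrC subrK => h4; lra.
Qed.

(** By convexity [(1 + t) ^+ n] lies below its chord over [[0, 1]], namely [1 + t * (2 ^+ n - 1)];
    this sharper form carries the induction. *)
Lemma exprD1_le (t : R) n : 0 <= t -> t <= 1 -> (1 + t) ^+ n <= 1 + t * 2 ^+ n.
Proof.
move=> t0 t1; suff : (1 + t) ^+ n <= 1 + t * (2 ^+ n - 1) by nra.
elim: n => [|n IH]; first by rewrite !expr0 subrr mulr0 addr0.
have h : 1 <= 2 ^+ n :> R by rewrite exprn_ege1 // ler1n.
rewrite !exprS; set x := (1 + t) ^+ n in IH *; set y := 2 ^+ n in IH h *.
have : (1 + t) * x <= (1 + t) * (1 + t * (y - 1)) by rewrite ler_wpM2l // addr_ge0.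
have : t * (t * (y - 1)) <= 1 * (t * (y - 1)) by rewrite ler_wpM2r // mulr_ge0 ?subr_ge0.
by move=> h1 h2; lra.
Qed.

Lemma exists_exp_near1 (n : nat) (M e : R) : 0 <= M -> 0 < e ->
  exists2 r : R, 1 < r & M * (r ^+ n - 1) <= e.
Proof.
move=> M0 e0; have y0 : 0 < (M + 1) * 2 ^+ n by rewrite mulr_gt0 ?exprn_gt0 ?ltr_wpDl.
(* The minimum with 1 admits the chord bound; the other term makes [M * t * 2 ^+ n] at most [e]. *)
pose t := Num.min 1 (e / ((M + 1) * 2 ^+ n)).
have t0 : 0 < t by rewrite lt_min ltr01 divr_gt0.
exists (1 + t); first by rewrite ltrDl.
have t1 : t <= 1 by rewrite ge_min lexx.
have := exprD1_le n (ltW t0) t1; rewrite -lerBlDl => h.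
have te : t * ((M + 1) * 2 ^+ n) <= e by rewrite -ler_pdivlMr // ge_min lexx orbT.
apply: le_trans (ler_wpM2l M0 h) _; apply: le_trans te.
rewrite mulrCA ler_wpM2l ?(ltW t0) // ler_wpM2r ?exprn_ge0 // lerDl //.
Qed.

Lemma exists_exp2_ge (x : R) : exists n, x <= 2 ^+ n.
Proof.
exists (Num.truncn `|x|).+1; apply: le_trans (ler_norm x) _.
have := truncnS_gt `|x|; move/ltW/le_trans; apply.
by rewrite -natrX ler_nat ltnW // ltn_expl.
Qed.

(* Write [F = p - e] with [p] a polynomial truncation and [norm e] small.
   On a slightly larger disc [p] is still bounded below, so Cauchy's
   estimates bound the norm of [p ^- N] by a fixed multiple of
   [(2 norm e) ^- N]; hence some power [h ^+ N] of [h := e / p] has norm at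
   most [1/2], and [G = p^-1 (1 + h + ... + h^(N-1)) + G h ^+ N]. *)
Theorem wiener_inverse_summable F G (A d : R) n0 : F * G = 1 ->
  norm_le cabs F A -> 0 < d ->
  (forall n z, (n0 <= n)%N -> cabs z <= 1 -> d <= cabs (trunc n F).[z]) ->
  exists B, norm_le cabs G B.
Proof.
(* Enlarging the disc may cost [p] one [ep] out of its lower bound [4 ep], leaving more than the
   [2 ep] that is used; against [norm e <= ep] this yields a factor [1/2] per power. *)
move=> FG FA d0 Fd; pose ep := d / 4.
have ep0 : 0 < ep by rewrite divr_gt0.
have [n1 tail] := psum_tail FA ep0.
pose p := trunc (n0 + n1)%N F; pose e := fps_of_poly p - F.
have eE : norm_le cabs e ep.
  move=> m; apply: le_trans (tail (n0 + n1)%N m ltac:(lia)).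
  have zlt k : (k < n0 + n1)%N -> coef e k = 0.
    by move=> kn; rewrite coefD_fps coefN_fps [X in X - _]coef_trunc ?subrr.
  have ege k : (n0 + n1 <= k)%N -> cabs (coef e k) = cabs (coef F k).
    move=> kn; rewrite coefD_fps coefN_fps [X in X - _]nth_default ?sub0r ?abvN //.
    by rewrite (leq_trans (size_poly _ _)).
  rewrite -(big_mkord xpredT (fun k => cabs (coef e k))).
  have [mn|nm] := leqP m (n0 + n1).
    rewrite big_nat_cond big1 ?sumr_ge0 // => [*|k /andP[/andP[_ km] _]]; first exact: abv_ge0.
    by rewrite zlt ?abv0 //; lia.
  rewrite (@big_cat_nat _ _ _ (n0 + n1)%N) ?(ltnW nm) // big_nat_cond big1 ?Monoid.mul1m.
    by rewrite big_nat_cond [leRHS]big_nat_cond; apply: ler_sum => k /andP[/andP[nk _] _]; rewrite ege.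
  by move=> k /andP[/andP[_ km] _]; rewrite zlt ?abv0.
pose P1 := \sum_(k < size p) cabs p`_k.
have P10 : 0 <= P1 by apply: sumr_ge0 => *; exact: abv_ge0.
have [r r1 hr] := exists_exp_near1 (size p) P10 ep0.
have r0 : 0 < r by apply: lt_trans r1.
pose rC : C := r%:C%C.
have rC0 : rC != 0 by rewrite /rC eq_complex /= eqxx andbT gt_eqF.
(* This is [p(r z)]: bounds on it over the unit disc are bounds on [p] over the disc of radius
   [r]. *)
pose pr := \poly_(k < size p) (rC ^+ k * p`_k).
have prd z : cabs z <= 1 -> ep *+ 2 <= cabs pr.[z].
  move=> z1; have h : cabs (p.[z] - pr.[z]) <= ep.
    apply: le_trans hr; rewrite [pr.[z]]horner_poly [p.[z]]horner_coef -sumrB mulr_suml.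
    apply: le_trans (abv_sum _ _ _ _) _; apply: ler_sum => k _.
    rewrite -mulrBl -{1}[p`_k]mul1r -mulrBl !abvM.
    have rk : 1 <= r ^+ k by rewrite exprn_ege1 // ltW.
    apply: le_trans (_ : cabs (1 - rC ^+ k) * cabs p`_k <= _).
      by rewrite ler_piMr ?mulr_ge0 ?abv_ge0 // abvX exprn_ile1 ?abv_ge0.
    rewrite mulrC.
    rewrite abvBC /rC -rmorphXn /= -(rmorph1 (real_complex R)) -rmorphB cabs_real.
    rewrite ger0_norm ?subr_ge0 // ler_wpM2l ?abv_ge0 // lerB //.
    by rewrite ler_weXn2l ?(ltW r1) // ltnW.
  have := Fd (n0 + n1)%N z ltac:(lia) z1; rewrite -/p => h1.
  have := abvD cabs pr.[z] (p.[z] - pr.[z]); rewrite [_ + (_ - _)]addrC subrK; move: h; rewrite /ep => h h2.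
  by rewrite mulr2n; lra.
have [br [B [prbr brB]]] : exists b B, fps_of_poly pr * b = 1 /\ norm_le cabs b B.
  apply: poly_inv_summable => z /prd; apply: contraTneq => ->.
  by rewrite abv0 -ltNge mulrn_wgt0.
pose b := dilate rC^-1 br.
have pE : fps_of_poly p = dilate rC^-1 (fps_of_poly pr).
  apply: fpsP => k /=; rewrite [pr`_k]coef_poly; case: ltnP => kp.
    by rewrite mulrA -exprMn mulVf // expr1n mul1r.
  by rewrite mulr0 nth_default.
have pb : fps_of_poly p * b = 1 by rewrite pE -dilateM prbr dilate1.
pose Cr := (1 - r^-1)^-1.
(* The coefficients of [br ^+ N] are bounded uniformly in [k]; undoing the dilation multiplies the
   [k]-th by [r ^- k], which makes them summable with a constant [Cr] independent of [N]. *)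
have bN N : norm_le cabs (b ^+ N) ((ep *+ 2) ^- N * Cr).
  move=> m; rewrite -dilateX.
  have rV1 : r^-1 < 1 by rewrite invf_lt1.
  have rV0 : 0 <= r^-1 by rewrite invr_ge0 ltW.
  apply: le_trans (ler_wpM2l _ (sum_geometric m rV0 rV1)); last first.
    by rewrite invr_ge0 exprn_ge0 // mulrn_wge0 // ltW.
  rewrite mulr_sumr; apply: ler_sum => k _; rewrite [leLHS](abvM cabs) abvX.
  rewrite cabsV cabs_real gtr0_norm // mulrC ler_wpM2r ?exprn_ge0 //.
  by apply: coef_inv_exp_le prbr brB; rewrite ?mulrn_wgt0.
pose h := e * b.
have [N hN] := exists_exp2_ge (Cr * 2).
have hN2 : norm_le cabs (h ^+ N) (1 / 2).
  move=> m; rewrite exprMn.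
  apply: le_trans (norm_leM (norm_leX N eE) (bN N) m) _.
  rewrite mulrA -exprVn -exprMn -[ep *+ 2]mulr_natr invfM mulrA divff ?gt_eqF // mul1r.
  by rewrite exprVn mulrC ler_pdivrMr ?exprn_gt0 //; lra.
have [M SM] : exists M, norm_le cabs (b * \sum_(k < N) h ^+ k) M.
  have hH := norm_leM eE (bN 1%N); rewrite expr1 -/h in hH.
  have [M' hM'] : exists M', norm_le cabs (\sum_(k < N) h ^+ k) M'.
    elim: (N) => [|n [M' IH]].
      by exists 0 => m; rewrite big_ord0 big1 // => k _; exact: abv0.
    by rewrite big_ord_recr; eexists; apply: norm_leD IH _; apply: norm_leX hH.
  have bB := bN 1%N; rewrite expr1 in bB.
  by eexists; apply: norm_leM bB hM'.
have GE : G = b * (\sum_(k < N) h ^+ k) + G * h ^+ N.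
  have bE : b = G * (1 - h).
    have -> : 1 - h = F * b by rewrite /h /e mulrBl pb opprB addrC subrK.
    by rewrite mulrA [G * F]mulrC FG mul1r.
  rewrite {1}bE -mulrA -opprB mulNr -subrX1 opprB mulrBr mulr1 subrK //.
(* Each partial sum [S] of [G] satisfies [S <= M + S / 2]. As [S] is a finite sum it can be absorbed
   on the left, although [G] is not yet known to be summable. *)
exists (M * 2) => m; have := psumM_le cabs G (h ^+ N) m => h1.
have : \sum_(k < m) cabs (coef G k) <=
    \sum_(k < m) cabs (coef (b * (\sum_(k < N) h ^+ k)) k) +
    \sum_(k < m) cabs (coef (G * h ^+ N) k).
  rewrite -big_split /=; apply: ler_sum => k _; rewrite {1}GE; exact: abvD.
have := SM m.
have : \sum_(k < m) cabs (coef G k) * \sum_(l < m - k) cabs (coef (h ^+ N) l) <=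
    (\sum_(k < m) cabs (coef G k)) * (1 / 2).
  by rewrite mulr_suml; apply: ler_sum => k _; apply: ler_wpM2l; rewrite ?abv_ge0.
by lra.
Qed.

End WienerLemma.

(** * Uniform lower bounds for truncations on the closed disc *)

Section UniformLowerBound.
Variable R : realType.
Local Notation C := R[i].
Implicit Types (z w : C) (a : fps C) (p : {poly C}).

(** [w ^+ k - z ^+ k] is [w - z] times [k] monomials of modulus at most 1. The 1 added to the
    constant keeps it positive, since it is divided by later. *)
Lemma horner_lipschitz p : exists2 L : R, 0 < L & forall z w,
  cabs z <= 1 -> cabs w <= 1 -> cabs (p.[w] - p.[z]) <= L * cabs (w - z).
Proof.
have L0 : 0 <= \sum_(k < size p) cabs p`_k * k%:R.
  by apply: sumr_ge0 => k _; rewrite mulr_ge0 ?abv_ge0.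
exists (\sum_(k < size p) cabs p`_k * k%:R + 1); first by rewrite ltr_wpDl.
move=> z w z1 w1; rewrite !horner_coef -sumrB mulrDl mul1r mulr_suml.
apply: le_trans (abv_sum _ _ _ _) _; apply: ler_wpDr; first exact: abv_ge0.
apply: ler_sum => k _; rewrite -mulrBr subrXX !abvM.
rewrite -mulrA ler_wpM2l ?abv_ge0 // mulrC ler_wpM2r ?abv_ge0 //.
apply: le_trans (abv_sum _ _ _ _) _; rewrite -[X in _ <= X%:R]card_ord -sumr_const.
apply: ler_sum => i _; rewrite abvM !abvX.
by rewrite mulr_ile1 ?exprn_ge0 ?exprn_ile1 ?abv_ge0.
Qed.

Lemma compact_unit_disc : compact [set x : R * R | x.1 ^+ 2 + x.2 ^+ 2 <= 1].
Proof.
have sq : compact (`[-1 : R, 1] `*` `[-1 : R, 1]).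
  by apply: compact_setX; exact: segment_compact.
apply: subclosed_compact sq _.
  have -> : [set x : R * R | x.1 ^+ 2 + x.2 ^+ 2 <= 1] =
      (fun x : R * R => x.1 ^+ 2 + x.2 ^+ 2) @^-1` [set y : R | y <= 1] by [].
  apply: closed_comp; last exact: closed_le.
  move=> x _; apply: cvgD; rewrite !expr2; apply: cvgM; (exact: cvg_fst || exact: cvg_snd).
by move=> [x y] /= h; split=> /=; rewrite in_itv /=; apply/andP; split; nra.
Qed.

(** Near each point the late truncations stay close to a nonzero limit; compactness makes both the
    bound and the threshold uniform. *)
Lemma trunc_lower_bound a A : norm_le cabs a A ->
  (forall z, cabs z <= 1 -> ~ converges cabs (psum (dilate z a)) 0) ->
  exists d n0, 0 < d /\
    forall n z, (n0 <= n)%N -> cabs z <= 1 -> d <= cabs (trunc n a).[z].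
Proof.
move=> aA a0; pose K := [set x : R * R | x.1 ^+ 2 + x.2 ^+ 2 <= 1].
pose toC (x : R * R) : C := Complex x.1 x.2.
have KE x : K x <-> cabs (toC x) <= 1.
  rewrite cabsE /= -[X in _ <= X]sqrtr1 ler_sqrt //.
(* The single index [n] encodes the threshold and the bound [1 / (n + 1)], so one covering argument,
   along [n] tending to infinity, settles both. *)
pose P n x := K x -> forall m, (n <= m)%N -> (n.+1%:R)^-1 <= cabs (trunc m a).[toC x].
suff : \forall n \near \oo, K `<=` P n.
  move=> [n _ /(_ n (leqnn n)) hn]; exists (n.+1%:R)^-1, n.
  split=> [|m [x y] nm z1]; first by rewrite invr_gt0.
  have Kz := (KE (x, y)).2 z1; exact: (hn _ Kz Kz m nm).
have /compact_near_coveringP := compact_unit_disc; apply => x Kx.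
have z1 : cabs (toC x) <= 1 by exact/KE.
have [l hl] := psum_is_cvg (norm_le_dilate z1 aA).
have l0 : 0 < cabs l by apply: cabs_gt0; apply/eqP => l0; apply: (a0 _ z1); rewrite -l0.
(* Three errors of size [eta] follow: from the limit to [p] at [x], from [x] to [x'], and from [p]
   to a later truncation. One [eta] remains as the lower bound. *)
pose eta := cabs l / 4; have eta0 : 0 < eta by rewrite divr_gt0.
have [n1 h1] := hl _ eta0; have [n2 h2] := psum_tail aA eta0.
pose n3 := (n1 + n2)%N; pose p := trunc n3 a.
have [L L0 hL] := horner_lipschitz p.
have e0 : 0 < eta / L / 2 by rewrite !divr_gt0.
have near_x : \forall x' \near x, cabs (toC x' - toC x) <= eta / L.
  apply/nbhs_ballP; exists (eta / L / 2) => //= -[u v] [/= hu hv].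
  apply: le_trans (cabs_le_ReIm _) _; rewrite /= [leRHS]splitr.
  by rewrite /ball /= in hu hv; apply: lerD; rewrite distrC ltW.
have near_n : \forall n \near \oo, (n3 <= n)%N /\ (n.+1%:R)^-1 <= eta.
  exists (n3 + Num.truncn eta^-1)%N => // n /= hn; split; first exact: leq_trans (leq_addr _ _) hn.
  rewrite -[leRHS]invrK lef_pV2 ?posrE ?invr_gt0 // ltW //.
  apply: lt_le_trans (truncnS_gt _) _; rewrite ler_nat ltnS.
  exact: leq_trans (leq_addl _ _) hn.
exists ([set x' | cabs (toC x' - toC x) <= eta / L],
        [set n | (n3 <= n)%N /\ (n.+1%:R)^-1 <= eta]) => //= -[x' n] /= [hx' [n3n etan]].
move=> /KE w1 m nm; apply: le_trans etan _.
have A1 := h1 n3 ltac:(rewrite /n3; lia); rewrite psum_dilateE -/p in A1.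
have A2 : cabs (p.[toC x'] - p.[toC x]) <= eta.
  by apply: le_trans (hL _ _ z1 w1) _; rewrite mulrC -ler_pdivlMr.
have A3 : cabs ((trunc m a).[toC x'] - p.[toC x']) <= eta.
  apply: trunc_tail_le => //; first by lia.
  by apply: h2; rewrite /n3; lia.
have tri (u v : C) : cabs u <= cabs v + cabs (v - u).
  by rewrite abvBC; have := abvD cabs v (u - v); rewrite [v + _]addrC subrK.
have T1 := tri l p.[toC x]; have T2 := tri p.[toC x] p.[toC x'].
have T3 := tri p.[toC x'] (trunc m a).[toC x'].
have lE : cabs l = eta * 4 by rewrite /eta; lra.
by lra.
Qed.

End UniformLowerBound.

(** * Quaternions and their slice decomposition *)

Section QuaternionModulus.
Variable R : realType.
Local Notation H := (quaternion R).
Implicit Types (p q : H) (x y : R).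

Lemma quaternionP p q : q0 p = q0 q -> q1 p = q1 q -> q2 p = q2 q -> q3 p = q3 q -> p = q.
Proof. by case: p q => a b c d [a' b' c' d'] /= -> -> -> ->. Qed.

Definition conjq q : H := Quaternion (q0 q) (- q1 q) (- q2 q) (- q3 q).

Lemma conjqM p q : conjq (p * q) = conjq q * conjq p.
Proof. by apply: quaternionP => /=; ring. Qed.

Fact conjq_additive : additive conjq.
Proof. by move=> p q; apply: quaternionP => /=; ring. Qed.
HB.instance Definition _ := GRing.isZmodMorphism.Build H H conjq conjq_additive.

Fact q0_additive : additive (@q0 R : H -> R).
Proof. by []. Qed.
HB.instance Definition _ := GRing.isZmodMorphism.Build H R (@q0 R) q0_additive.

Lemma conjqK : involutive conjq.
Proof. by move=> q; apply: quaternionP => /=; rewrite ?opprK. Qed.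

Lemma q0M q p : q0 (p * q) = q0 (q * p).
Proof. by rewrite /=; ring. Qed.

Lemma conjq_real q : conjq q = q -> q = (q0 q)%:A.
Proof.
by case: q => a b c d [? ? ?]; apply: quaternionP => /=; lra.
Qed.

Lemma mulq_conj q : q * conjq q = (dotq q q)%:A.
Proof. by apply: quaternionP; rewrite /dotq /=; ring. Qed.

Lemma normqE q : `|q| = Num.sqrt (dotq q q).
Proof. by []. Qed.

Lemma normqM p q : `|p * q| = `|p| * `|q|.
Proof.
rewrite !normqE -sqrtrM ?dotqq_ge0 //; congr Num.sqrt.
by rewrite /dotq /=; ring.
Qed.

Lemma normq1 : `|1 : H| = 1.
Proof. by rewrite normqE /dotq /= !mulr0 !addr0 mul1r sqrtr1. Qed.

Fact qabs_eq0 q : `|q| = 0 -> q = 0.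
Proof. by move/eqP; rewrite normr_eq0 => /eqP. Qed.

Definition qabs : absval R H := @Absval R H (fun q => `|q|) (@normr_ge0 _ _)
  (normr0 H) qabs_eq0 normq1 (@normrN _ _) normqM (@ler_normD _ _).

Lemma qabsE q : qabs q = `|q|. Proof. by []. Qed.

Lemma normq_conj q : `|conjq q| = `|q|.
Proof. by rewrite !normqE /dotq /= !mulrNN. Qed.

Lemma mulq_eq1C p q : p * q = 1 -> q * p = 1.
Proof.
move=> pq; have p0 : dotq p p != 0.
  apply/eqP => p0; have : `|p * q| = 0 by rewrite normqM [`|p|]normqE p0 sqrtr0 mul0r.
  by rewrite pq normq1 => /eqP; rewrite oner_eq0.
have conjE : conjq p = dotq p p *: q.
  rewrite -[LHS]mulr1 -pq mulrA -[X in _ * X * _]conjqK mulq_conj -scalerAl mul1r.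
  by congr (_ *: _); rewrite /dotq /= !mulrNN.
apply: (scalerI p0); rewrite scalerAl -conjE -[X in _ * X]conjqK mulq_conj.
by congr (_ *: _); rewrite /dotq /= !mulrNN.
Qed.

Lemma quaternion_inv_exists q : q != 0 -> exists r : H, q * r = 1 /\ r * q = 1.
Proof.
move=> q0; have d0 : dotq q q != 0.
  by apply: contra q0 => /eqP d0; rewrite -normr_eq0 normqE d0 sqrtr0.
have qr : q * ((dotq q q)^-1 *: conjq q) = 1.
  by rewrite -scalerAr mulq_conj scalerA mulVf // scale1r.
by exists ((dotq q q)^-1 *: conjq q); split=> //; exact: mulq_eq1C.
Qed.

End QuaternionModulus.

Section SliceDecomposition.
Variables (R : realType) (i j : quaternion R).
Hypothesis hij : orthogonal_units i j.
Local Notation H := (quaternion R).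
Local Notation C := R[i].
Implicit Types (p q : H) (z w : C).

Lemma sqr_i : i * i = -1.
Proof. by case: hij => + _ _; rewrite /imag_sphere /= expr2. Qed.

Lemma sqr_j : j * j = -1.
Proof. by case: hij => _ + _; rewrite /imag_sphere /= expr2. Qed.

Lemma mulq_ji : j * i = - (i * j).
Proof. by case: hij => _ _ /eqP; rewrite addrC addr_eq0 => /eqP. Qed.

Fact slice_additive : additive (slice i).
Proof.
move=> z w; rewrite /slice !raddfB /= !scalerBl opprD.
by rewrite addrACA.
Qed.
HB.instance Definition _ := GRing.isZmodMorphism.Build C H (slice i) slice_additive.

Lemma slice1 : slice i 1 = 1.
Proof. by rewrite /slice /= scale1r scale0r addr0. Qed.

Lemma sliceM z w : slice i (z * w) = slice i z * slice i w.
Proof.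
case: z w => [a b] [c d].
rewrite /slice /= !mulrDl !mulrDr -!scalerAl -!scalerAr !mul1r !mulr1.
rewrite sqr_i !scalerN !scalerA scalerBl scalerDl addrACA.
by congr (_ + _); rewrite addrC.
Qed.

Lemma mulq_j_slice z : j * slice i z = slice i z^*%C * j.
Proof.
case: z => a b; rewrite /slice /= mulrDr mulrDl -!scalerAr -!scalerAl mulr1 mul1r.
by rewrite mulq_ji scalerN scaleNr.
Qed.

Fact zpart_additive : additive (zpart i j).
Proof.
by move=> p q; apply/eqP; rewrite eq_complex /zpart /dotq /=; apply/andP; split; apply/eqP; ring.
Qed.
HB.instance Definition _ := GRing.isZmodMorphism.Build H C (zpart i j) zpart_additive.
Fact wpart_additive : additive (wpart i j).
Proof.
by move=> p q; apply/eqP; rewrite eq_complex /wpart /dotq /=; apply/andP; split; apply/eqP; ring.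
Qed.
HB.instance Definition _ := GRing.isZmodMorphism.Build H C (wpart i j) wpart_additive.

(** The first row of [chi(p q) = chi(p) chi(q)]; it comes from [j] conjugating whatever slice
    element it passes. That row determines the matrix, so [chi] itself is never formed. *)
Lemma zwpartM p q :
  zpart i j (p * q) = zpart i j p * zpart i j q - wpart i j p * (wpart i j q)^*%C /\
  wpart i j (p * q) = zpart i j p * wpart i j q + wpart i j p * (zpart i j q)^*%C.
Proof.
have key (x y u v u' v' : H) : j * u = u' * j -> j * v = v' * j ->
    (x + y * j) * (u + v * j) = x * u - y * v' + (x * v + y * u') * j.
  move=> ju jv; rewrite mulrDl !mulrDr mulrDl -[y * j * u]mulrA ju.
  rewrite -[y * j * _]mulrA [j * (v * j)]mulrA jv -mulrA sqr_j mulrN1 mulrN.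
  rewrite !mulrA -!addrA; congr (_ + _); rewrite [RHS]addrCA; congr (_ + _).
  by rewrite addrC.
rewrite [in zpart i j (_ * _)](zwpart_decomp p hij) [in wpart i j (_ * _)](zwpart_decomp p hij).
rewrite [X in zpart i j (_ * X)](zwpart_decomp q hij) [X in wpart i j (_ * X)](zwpart_decomp q hij).
set a := zpart i j p; set b := wpart i j p; set c := zpart i j q; set d := wpart i j q.
have -> : (slice i a + slice i b * j) * (slice i c + slice i d * j) =
    slice i (a * c - b * d^*%C) + slice i (a * d + b * c^*%C) * j.
  by rewrite (key _ _ _ _ _ _ (mulq_j_slice c) (mulq_j_slice d)) (raddfB (slice i)) (raddfD (slice i)) -!sliceM.
exact: zwpart_uniq.
Qed.

Lemma zpartM p q :
  zpart i j (p * q) = zpart i j p * zpart i j q - wpart i j p * (wpart i j q)^*%C.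
Proof. by have [] := zwpartM p q. Qed.

Lemma wpartM p q :
  wpart i j (p * q) = zpart i j p * wpart i j q + wpart i j p * (zpart i j q)^*%C.
Proof. by have [] := zwpartM p q. Qed.

Lemma zpart_slice z : zpart i j (slice i z) = z.
Proof. by have [+ _] := zwpart_uniq z 0 hij; rewrite raddf0 mul0r addr0. Qed.

Lemma wpart_slice z : wpart i j (slice i z) = 0.
Proof. by have [_] := zwpart_uniq z 0 hij; rewrite raddf0 mul0r addr0. Qed.

Lemma dotq_conj q p : q0 p = 0 -> dotq (conjq q) p = - dotq q p.
Proof. by move=> p0; rewrite /dotq /= p0; ring. Qed.

Lemma zpart_conj q : zpart i j (conjq q) = (zpart i j q)^*%C.
Proof.
have [i0 _ _ _ _] := orthogonal_unitsP hij.
rewrite /zpart (dotq_conj _ i0); apply/eqP; rewrite eq_complex /=.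
by apply/andP; split; apply/eqP; rewrite /dotq /=; ring.
Qed.

Lemma wpart_conj q : wpart i j (conjq q) = - wpart i j q.
Proof.
have [i0 j0 _ _ ij0] := orthogonal_unitsP hij.
have k0 : q0 (i * j) = 0 by rewrite /= i0 j0; lra.
by rewrite /wpart !dotq_conj.
Qed.

Lemma zpart_real x : zpart i j (x%:A) = x%:C%C.
Proof.
by rewrite -[RHS]zpart_slice /slice /= scale0r addr0.
Qed.

Lemma norm_zw_sqr q : `|q| ^+ 2 = cabs (zpart i j q) ^+ 2 + cabs (wpart i j q) ^+ 2.
Proof.
have /(congr1 (zpart i j)) := mulq_conj q.
rewrite zpartM zpart_conj wpart_conj zpart_real rmorphN /= mulrN opprK.
rewrite -!sqr_normc !norm_cabs -!rmorphXn -rmorphD => -[->].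
by rewrite normqE sqr_sqrtr // dotqq_ge0.
Qed.

Lemma cabs_zpart_le q : cabs (zpart i j q) <= `|q|.
Proof. by rewrite -(ler_pXn2r (n := 2)) ?nnegrE ?abv_ge0 // norm_zw_sqr lerDl sqr_ge0. Qed.

Lemma cabs_wpart_le q : cabs (wpart i j q) <= `|q|.
Proof. by rewrite -(ler_pXn2r (n := 2)) ?nnegrE ?abv_ge0 // norm_zw_sqr lerDr sqr_ge0. Qed.

Lemma norm_le_zw q : `|q| <= cabs (zpart i j q) + cabs (wpart i j q).
Proof.
rewrite -(ler_pXn2r (n := 2)) ?nnegrE ?addr_ge0 ?abv_ge0 // norm_zw_sqr sqrrD.
by rewrite -addrA lerD2l lerDr mulrn_wge0 ?mulr_ge0 ?abv_ge0.
Qed.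

Lemma norm_slice z : `|slice i z| = cabs z.
Proof.
apply/eqP; rewrite -(eqrXn2 (n := 2)) ?abv_ge0 // norm_zw_sqr zpart_slice wpart_slice.
by rewrite abv0 expr0n addr0.
Qed.

(* If [p = x + v] with [v] purely imaginary and [v ^+ 2 = - y ^+ 2], then
   [u := y - i v] satisfies [u v = y i u]; it degenerates only for
   [v = - y i], where [j] works. *)
Lemma conjugate_to_slice p : exists u z, [/\ u != 0, u * p = slice i z * u & cabs z = `|p|].
Proof.
pose x := q0 p; pose v : H := p - x%:A; pose y := Num.sqrt (q1 p ^+ 2 + q2 p ^+ 2 + q3 p ^+ 2).
have vv : v * v = - (y ^+ 2)%:A.
  rewrite sqr_sqrtr ?addr_ge0 ?sqr_ge0 //.
  by apply: quaternionP; rewrite /v /x /=; ring.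
have pE : p = x%:A + v by rewrite /v addrC subrK.
clearbody v.
have upE u : u * v = (y *: i) * u -> u * p = slice i (Complex x y) * u.
  by move=> uv; rewrite {1}pE mulrDr uv /slice mulrDl -!scalerAl -!scalerAr mul1r mulr1.
have main u : u != 0 -> u * v = (y *: i) * u ->
    exists u z, [/\ u != 0, u * p = slice i z * u & cabs z = `|p|].
  move=> u0 /upE up; exists u, (Complex x y); split=> //.
  have : `|u| != 0 by rewrite normr_eq0.
  by move/mulfI; apply; rewrite -normqM up normqM norm_slice mulrC.
have [u0|] := eqVneq (y%:A - i * v) 0; last first.
  move/main; apply; rewrite mulrBl mulrBr -[i * v * v]mulrA vv mulrN opprK.
  rewrite -!scalerAl -!scalerAr mul1r !mulr1.
  rewrite [i * (i * v)]mulrA sqr_i mulN1r.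
  by rewrite scalerN opprK addrC scalerA expr2.
have vE : v = - (y *: i).
  move/subr0_eq: u0 => /(congr1 ( *%R i)); rewrite mulrA sqr_i mulN1r -scalerAr mulr1.
  by move=> ->; rewrite opprK.
apply: (main j).
  apply/eqP => j0; have := sqr_j; rewrite j0 mul0r => /eqP.
  by rewrite eq_sym oppr_eq0 oner_eq0.
by rewrite vE mulrN -scalerAr mulq_ji scalerN opprK scalerAl.
Qed.

End SliceDecomposition.

(** * The Wiener algebra as an algebra of power series *)

Section WienerPlus.
Variable R : realType.
Local Notation H := (quaternion R).
Implicit Types (f g : int -> H) (a b : fps H).

Definition fps_of_int f : fps H := Fps (fun n => f (Posz n)).
Definition int_of_fps a : int -> H := fun u => if u is Posz n then coef a n else 0.

Lemma int_of_fpsK : cancel int_of_fps fps_of_int.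
Proof. by move=> a; apply: fpsP. Qed.

Lemma esum_Posz f : (forall u, u < 0 -> f u = 0) ->
  (\esum_(u in [set: int]) `| (`|f u|)%:E | = \sum_(0 <= n <oo) (`|f (Posz n)|)%:E)%E.
Proof.
move=> f0; transitivity (\esum_(u in range Posz) (`|f u|)%:E)%E.
  rewrite [RHS]esum_mkcond; apply: eq_esum => -[n|n] _.
    by rewrite mem_set /= ?normr_id //; exists n.
  rewrite memNset; first by rewrite f0 // normr0 abse0.
  by move=> [].
rewrite (reindex_esum setT _ Posz); last first.
  by split=> [n _|m n _ _ []|_ [n _ <-]] //=; exists n.
by rewrite nneseries_esumT // => n _; rewrite lee_fin.
Qed.

Lemma wiener_plusP f : wiener_plus f <->
  (forall u, u < 0 -> f u = 0) /\ exists A, norm_le (@qabs R) (fps_of_int f) A.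
Proof.
pose S := (\sum_(0 <= n <oo) (`|f (Posz n)|)%:E)%E.
have S0 n : (0 <= n)%N -> true -> (0 <= (`|f (Posz n)|)%:E)%E.
  by move=> _ _; rewrite lee_fin.
split=> -[].
  move=> fw f0; split=> //; move: fw; rewrite /wiener /= /summable esum_Posz // => Soo.
  have Sfin : S \is a fin_num by rewrite ge0_fin_numE //; apply: nneseries_ge0.
  exists (fine S) => m; rewrite -lee_fin fineK //.
  apply: le_trans (nneseries_lim_ge m S0).
  by rewrite sumEFin big_mkord.
move=> f0 [A fA]; split=> //; rewrite /wiener /= /summable esum_Posz //.
apply: le_lt_trans (ltry A); apply: lime_le; first exact: is_cvg_nneseries.
by apply: nearW => m; rewrite sumEFin lee_fin big_mkord; exact: fA.
Qed.

Lemma lim_eventually_cst (s : nat -> H) l m :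
  (forall n, (m <= n)%N -> s n = l) -> limn s = l.
Proof.
move=> sl; apply: cvg_lim; first exact: norm_hausdorff.
by apply: cvg_near_cst; exists m.
Qed.

(** Both limits in [int_sum] are of eventually constant sequences: [g] kills the negative [k], and
    [f] kills the [k] beyond [u]. The product thus becomes purely algebraic. *)
Lemma star_fps f g : (forall u, u < 0 -> f u = 0) -> (forall u, u < 0 -> g u = 0) ->
  star f g = int_of_fps (fps_of_int f * fps_of_int g).
Proof.
move=> f0 g0; apply/funext => u; rewrite /star /int_sum.
rewrite [X in _ + X](@lim_eventually_cst _ 0 0%N) ?addr0 => [|n _]; last first.
  by rewrite /series /= big1 // => k _; rewrite g0 // mulr0.
case: u => n /=.
  apply: (@lim_eventually_cst _ _ n.+1) => m nm.
  rewrite /series /= (@big_cat_nat _ _ _ n.+1) //= [X in _ + X]big_nat_cond.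
  rewrite [X in _ + X]big1 ?addr0 => [|k /andP[/andP[nk _] _]]; last by rewrite f0 ?mul0r //; lia.
  rewrite big_mkord [RHS](reindex_inj rev_ord_inj) /=; apply: eq_bigr => k _.
  by have kn := ltn_ord k; rewrite subzn ?subSS ?subKn // -ltnS.
apply: (@lim_eventually_cst _ _ 0%N) => m _.
by rewrite /series /= big1 // => k _; rewrite f0 ?mul0r //; lia.
Qed.

Lemma star_oneE : @star_one R = int_of_fps 1.
Proof. by apply/funext => -[n|n] //; rewrite /star_one /= coefC; case: n. Qed.

Lemma wiener_plus_invertibleP f : wiener_plus f ->
  wiener_plus_invertible f <->
  exists b, [/\ exists B, norm_le (@qabs R) b B, fps_of_int f * b = 1 & b * fps_of_int f = 1].
Proof.
move=> [_ f0]; split=> [[g [/wiener_plusP[g0 gB]]]|[b [bB fb bf]]].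
  rewrite !star_fps // star_oneE => /(congr1 fps_of_int) + /(congr1 fps_of_int).
  by rewrite !int_of_fpsK => fg gf; exists (fps_of_int g).
have b0 u : u < 0 -> int_of_fps b u = 0 by case: u.
exists (int_of_fps b); split.
- by apply/wiener_plusP; split=> //; rewrite int_of_fpsK.
- by rewrite star_fps // int_of_fpsK fb star_oneE.
- by rewrite star_fps // int_of_fpsK bf star_oneE.
Qed.

Lemma converges_lim (s : nat -> H) l : converges (@qabs R) s l -> limn s = l.
Proof.
move=> sl; apply: cvg_lim; first exact: norm_hausdorff.
apply/cvgrPdist_le => e e0; have [n0 h] := sl _ e0.
by exists n0 => // n /h; rewrite qabsE distrC.
Qed.

Lemma closure_unit_ball_le (D : set H) p : closure (unit_ball `&` D) p -> `|p| <= 1.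
Proof.
move=> cl; apply/ler_addgt0Pr => e e0.
have [q [[q1 _]]] := cl _ (nbhsx_ballx p e e0).
rewrite -ball_normE /= => pq; rewrite /unit_ball /= in q1.
by have := ler_normD q (p - q); rewrite addrC subrK; lra.
Qed.

(** The points [(1 - t) p] approach [p] from inside the ball. Stability under real scaling covers
    both a slice and the whole of [H]. *)
Lemma closure_unit_ball (D : set H) p : (forall t : R, D (t *: p)) -> `|p| <= 1 ->
  closure (unit_ball `&` D) p.
Proof.
move=> Dp p1 B /nbhs_ballP[e /= e0 eB]; have m0 : 0 < Num.min e 1 by rewrite lt_min e0 ltr01.
have me : Num.min e 1 <= e by rewrite ge_min lexx.
have m1 : Num.min e 1 <= 1 by rewrite ge_min lexx orbT.
pose t := Num.min e 1 / 2; have [t0 te t1] : [/\ 0 < t, t < e & t < 1].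
  by rewrite /t; split; lra.
have p0 := normr_ge0 p.
exists ((1 - t) *: p); split; first split=> //.
  by rewrite /unit_ball /= normrZ ger0_norm ?subr_ge0 ?(ltW t1) //; nra.
apply: eB; rewrite -ball_normE /= -[p in p - _]scale1r -scalerBl opprB addrC subrK.
by rewrite normrZ gtr0_norm //; nra.
Qed.

End WienerPlus.

(** * Symmetrization and the matrix of a series *)

Section Symmetrization.
Variable R : realType.
Local Notation H := (quaternion R).
Local Notation C := R[i].
Implicit Types (a b : fps H).

Definition conj_fps a : fps H := Fps (fun n => conjq (coef a n)).

(* The coefficients of [a * conj_fps a] are real. *)
Definition symm_fps a : fps R := Fps (fun n => q0 (coef (a * conj_fps a) n)).

Lemma conj_fpsM a b : conj_fps (a * b) = conj_fps b * conj_fps a.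
Proof.
apply: fpsP => n /=; rewrite raddf_sum (reindex_inj rev_ord_inj) /=.
apply: eq_bigr => k _; rewrite conjqM subSS subKn //.
by rewrite -ltnS.
Qed.

Lemma conj_fpsK : involutive conj_fps.
Proof. by move=> a; apply: fpsP => n /=; rewrite conjqK. Qed.

Lemma conj_fps_real a : conj_fps a = a -> map_fps (in_alg H) (Fps (fun n => q0 (coef a n))) = a.
Proof.
move=> aE; apply: fpsP => n /=; rewrite [in RHS](@conjq_real R (coef a n)) //.
by rewrite -[in RHS]aE.
Qed.

Lemma symm_fpsE a : map_fps (in_alg H) (symm_fps a) = a * conj_fps a.
Proof. by rewrite conj_fps_real // conj_fpsM conj_fpsK. Qed.

(** Both products have real coefficients, which agree because [q0] is a trace:
    [q0 (p * q) = q0 (q * p)]. This makes the right inverse of a series a left one as well. *)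
Lemma symm_fpsC a : map_fps (in_alg H) (symm_fps a) = conj_fps a * a.
Proof.
rewrite -[RHS]conj_fps_real; last by rewrite conj_fpsM conj_fpsK.
congr (map_fps _ _); apply: fpsP => n.
change (q0 (coef (a * conj_fps a) n) = q0 (coef (conj_fps a * a) n)).
rewrite !coefM_fps !raddf_sum [LHS](reindex_inj rev_ord_inj).
apply: eq_bigr => k _; apply: etrans (q0M _ _) _.
by rewrite [rev_ord k : nat]/= subSS subKn // -ltnS.
Qed.

Lemma map_in_alg_central (r : fps R) a : map_fps (in_alg H) r * a = a * map_fps (in_alg H) r.
Proof.
apply: fpsP => n; rewrite !coefM_fps [RHS](reindex_inj rev_ord_inj) /=.
apply: eq_bigr => k _; rewrite subSS subKn; last by rewrite -ltnS.
by rewrite -scalerAl -scalerAr mul1r mulr1.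
Qed.

Lemma map_in_alg_inj : injective (map_fps (in_alg H)).
Proof.
move=> r s /(congr1 (fun a => coef a)) rs; apply: fpsP => n.
by have /(congr1 (@q0 R)) := congr1 (fun c => c n) rs; rewrite /= !mulr1.
Qed.

Lemma norm_le_conj a A : norm_le (@qabs R) a A -> norm_le (@qabs R) (conj_fps a) A.
Proof.
by move=> aA m; apply: le_trans (aA m); apply: ler_sum => k _; rewrite !qabsE normq_conj.
Qed.

(** [b * conj_fps b] is real, hence central, so it can be moved inside [a * conj_fps a], giving
    [(a * b) * conj_fps (a * b)]. *)
Lemma symm_fps_eq1 a b : a * b = 1 -> symm_fps a * symm_fps b = 1.
Proof.
move=> ab; apply: map_in_alg_inj; rewrite rmorphM rmorph1 /= symm_fpsE.
rewrite -mulrA -map_in_alg_central symm_fpsE -mulrA mulrA -conj_fpsM ab mul1r.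
apply: fpsP => n; rewrite /= !coefC; case: n => [|n] /=; last by rewrite raddf0.
by apply: quaternionP; rewrite /= ?oppr0.
Qed.

Lemma norm_le_symm a A : norm_le (@qabs R) a A ->
  norm_le cabs (map_fps (real_complex R) (symm_fps a)) (A * A).
Proof.
move=> aA m; apply: le_trans (norm_leM aA (norm_le_conj aA) m); rewrite -symm_fpsE.
apply: ler_sum => k _; rewrite cabs_real qabsE /= normrZ normq1 mulr1 //.
Qed.

End Symmetrization.

(** * The matrix [omega], its determinant and its action on row vectors *)

Section Omega.
Variables (R : realType) (i j : quaternion R).
Hypothesis hij : orthogonal_units i j.
Local Notation H := (quaternion R).
Local Notation C := R[i].
Variables (f : int -> H) (A : R).
Hypothesis fA : norm_le (@qabs R) (fps_of_int f) A.
Implicit Types (z : C).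

Let a : fps C := Fps (fun n => zpart i j (f (Posz n))).
Let b : fps C := Fps (fun n => wpart i j (f (Posz n))).
Local Notation conjf := (map_fps (@conjc R)).

Lemma cpower_seriesE (c : nat -> C) z l :
  converges cabs (psum (dilate z (Fps c))) l -> cpower_series c z = l.
Proof.
move=> cl; rewrite /cpower_series; apply: (@cvg_lim C^o); first exact: norm_hausdorff.
apply/cvgrPdist_le => e e0.
(* Here [e] ranges over [R[i]]; being positive it is real. *)
have eE : e = (complex.Re e)%:C%C by rewrite RRe_real // ger0_real // ltW.
have Re0 : 0 < complex.Re e by move: e0; rewrite ltcE => /andP[].
have [n0 h] := cl _ Re0; exists n0 => // n /h.
rewrite eE norm_cabs lecR abvBC; congr (cabs (_ - _) <= _).
by rewrite /psum /series /= big_mkord.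
Qed.

Lemma converges_conj (c : fps C) z l : converges cabs (psum (dilate z^*%C c)) l ->
  converges cabs (psum (dilate z (conjf c))) l^*%C.
Proof.
move=> h e /h[n0 {}h]; exists n0 => n /h; rewrite -cabsJ rmorphB /=.
congr (cabs (_ - _) <= _); rewrite /psum rmorph_sum /=; apply: eq_bigr => k _.
by rewrite rmorphM rmorphXn /= conjcK.
Qed.

Lemma norm_le_zpart : norm_le cabs a A.
Proof. by move=> m; apply: le_trans (fA m); apply: ler_sum => k _; exact: cabs_zpart_le. Qed.

Lemma norm_le_wpart : norm_le cabs b A.
Proof. by move=> m; apply: le_trans (fA m); apply: ler_sum => k _; exact: cabs_wpart_le. Qed.

(** A real quaternion is its own [zpart], so the product rule for [zpart] computes the whole of
    [s * conj_fps s]. *)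
Lemma symm_fps_omega :
  map_fps (real_complex R) (symm_fps (fps_of_int f)) = a * conjf a + b * conjf b.
Proof.
apply: fpsP => n; set s := fps_of_int f.
have -> : coef (map_fps (real_complex R) (symm_fps s)) n = zpart i j (coef (s * conj_fps s) n).
  by rewrite -symm_fpsE /= zpart_real.
rewrite coefM_fps raddf_sum coefD_fps !coefM_fps -big_split /=; apply: eq_bigr => k _.
by rewrite (zpartM hij) (zpart_conj hij) (wpart_conj hij) rmorphN /= mulrN opprK.
Qed.

Lemma omega_entries z : cabs z <= 1 -> exists la lb la' lb',
  [/\ converges cabs (psum (dilate z a)) la,
      converges cabs (psum (dilate z b)) lb,
      converges cabs (psum (dilate z (conjf a))) la',
      converges cabs (psum (dilate z (conjf b))) lb' &
      omega i j f z = \matrix_(k < 2, l < 2)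
        if k == 0 then if l == 0 then la else lb
        else if l == 0 then - lb' else la'].
Proof.
move=> z1; have z1' : cabs z^*%C <= 1 by rewrite cabsJ.
have [la hla] := psum_is_cvg (norm_le_dilate z1 norm_le_zpart).
have [lb hlb] := psum_is_cvg (norm_le_dilate z1 norm_le_wpart).
have [la' hla'] := psum_is_cvg (norm_le_dilate z1' norm_le_zpart).
have [lb' hlb'] := psum_is_cvg (norm_le_dilate z1' norm_le_wpart).
exists la, lb, la'^*%C, lb'^*%C; split=> //; try exact: converges_conj.
by rewrite /omega (cpower_seriesE hla) (cpower_seriesE hlb) (cpower_seriesE hla') (cpower_seriesE hlb').
Qed.

(** The expanded determinant is the sum of two products of entries, each the value of a Cauchy
    product. Stated as convergence, it turns a vanishing determinant into a series with sum 0. *)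
Lemma det_omega z : cabs z <= 1 ->
  converges cabs (psum (dilate z (map_fps (real_complex R) (symm_fps (fps_of_int f)))))
    (\det (omega i j f z)).
Proof.
move=> z1; have [la [lb [la' [lb' [hla hlb hla' hlb' ->]]]]] := omega_entries z1.
rewrite (expand_det_row _ 0) !big_ord_recl big_ord0 /cofactor !det_mx11 !mxE /= !addn0 expr0 expr1 addr0 mul1r.
rewrite mulN1r opprK symm_fps_omega.
have pa := psum_cauchy_product (norm_le_dilate z1 norm_le_zpart) hla hla'.
have pb := psum_cauchy_product (norm_le_dilate z1 norm_le_wpart) hlb hlb'.
apply: (converges_ext _ (convergesD pa pb)) => n.
rewrite -!dilateM /psum -big_split /=; apply: eq_bigr => k _.
by rewrite -mulrDr.
Qed.

(** Since [u p^n = z^n u], one has [u f(p) = \sum_n z^n (u f_n)], and the two parts of [u f_n] form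
    the row of [u] times [chi(f_n)]. *)
Lemma omega_row_eval p u z : u != 0 -> u * p = slice i z * u -> cabs z <= 1 ->
  let v := \row_k (if k == 0 :> 'I_2 then zpart i j u else wpart i j u) in
  zpart i j (u * wiener_plus_eval f p) = (v *m omega i j f z) 0 0 /\
  wpart i j (u * wiener_plus_eval f p) = (v *m omega i j f z) 0 1.
Proof.
move=> u0 up z1 v; have [la [lb [la' [lb' [hla hlb hla' hlb' oE]]]]] := omega_entries z1.
have -> : (v *m omega i j f z) 0 0 = zpart i j u * la - wpart i j u * lb'.
  by rewrite oE mxE !big_ord_recl big_ord0 !mxE /= addr0 mulrN.
have -> : (v *m omega i j f z) 0 1 = zpart i j u * lb + wpart i j u * la'.
  by rewrite oE mxE !big_ord_recl big_ord0 !mxE /= addr0.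
set Z := _ - _; set W := _ + _.
pose s := series (fun n : nat => p ^+ n * f (Posz n)).
have uX n : u * p ^+ n = slice i (z ^+ n) * u.
  elim: n => [|n IH]; first by rewrite !expr0 slice1 mulr1 mul1r.
  by rewrite exprSr mulrA IH -mulrA up mulrA exprSr (sliceM hij).
have us n : u * s n = \sum_(k < n) slice i (z ^+ k) * (u * f (Posz k)).
  rewrite /s /series /= big_mkord mulr_sumr; apply: eq_bigr => k _.
  by rewrite !mulrA uX.
have zs : converges cabs (fun n => zpart i j (u * s n)) Z.
  rewrite /Z -mulNr; apply: (converges_ext _ (convergesD
    (convergesMl (zpart i j u) hla) (convergesMl (- wpart i j u) hlb'))) => n.
  rewrite us raddf_sum /psum !mulr_sumr -big_split /=; apply: eq_bigr => k _.
  rewrite !(zpartM hij) (zpart_slice hij) (wpart_slice hij) mul0r subr0.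
  by rewrite mulrBr !mulNr !mulrA ![_ * z ^+ k]mulrC.
have ws : converges cabs (fun n => wpart i j (u * s n)) W.
  apply: (converges_ext _ (convergesD
    (convergesMl (zpart i j u) hlb) (convergesMl (wpart i j u) hla'))) => n.
  rewrite us raddf_sum /psum !mulr_sumr -big_split /=; apply: eq_bigr => k _.
  rewrite !(wpartM hij) (zpart_slice hij) (wpart_slice hij) mul0r addr0.
  by rewrite mulrDr !mulrA ![_ * z ^+ k]mulrC.
(* The series at [p] must be shown to converge before its [limn] means anything: convergence of the
   two complex coordinates gives it for [u * s n], and [u] is then cancelled. *)
pose L := slice i Z + slice i W * j.
have [zL wL] : zpart i j L = Z /\ wpart i j L = W := zwpart_uniq Z W hij.
have usL : converges (@qabs R) (fun n => u * s n) L.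
  move=> e e0; have e2 : 0 < e / 2 by rewrite divr_gt0.
  have [n1 h1] := zs _ e2; have [n2 h2] := ws _ e2; exists (n1 + n2)%N => n hn.
  rewrite qabsE; apply: le_trans (norm_le_zw hij _) _; rewrite !raddfB /= zL wL.
  by rewrite (splitr e); apply: lerD; [apply: h1|apply: h2]; lia.
have [r [ur ru]] := quaternion_inv_exists u0.
have sL : converges (@qabs R) s (r * L).
  by apply: (converges_ext _ (convergesMl r usL)) => n; rewrite mulrA ru mul1r.
by rewrite /wiener_plus_eval -/s (converges_lim sL) mulrA ur mul1r.
Qed.

End Omega.

Theorem theorem2p8 (R : realType) (f : int -> quaternion R)
    (hf : wiener_plus f) (i j : quaternion R) (hij : orthogonal_units i j) :
  [<-> wiener_plus_invertible f;
       forall z : R[i],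
         closure (unit_ball `&` range (slice i)) (slice i z) ->
         \det (omega i j f z) <> 0;
       forall p : quaternion R,
         closure (unit_ball) p -> wiener_plus_eval f p <> 0].
Proof.
have [f0 [A fA]] := (wiener_plusP f).1 hf.
set s := fps_of_int f in fA.
have slice_closure z : closure (unit_ball `&` range (slice i)) (slice i z) <-> cabs z <= 1.
  rewrite -(norm_slice hij); split; first exact: closure_unit_ball_le.
  apply: closure_unit_ball => t; exists (t%:C%C * z) => //.
  rewrite /slice; case: z => x y /=.
  by rewrite !mul0r subr0 addr0 scalerDr !scalerA.
have ball_closure p : closure unit_ball p <-> `|p| <= 1.
  rewrite -[unit_ball]setIT; split; first exact: closure_unit_ball_le.
  exact: closure_unit_ball.
tfae.
- move/(wiener_plus_invertibleP hf).1 => [b [[B bB] sb bs]] z /slice_closure z1 det0.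
  have := symm_fps_eq1 sb => /(congr1 (map_fps (real_complex R))).
  rewrite rmorphM rmorph1 /= => ss.
  have hs := det_omega hij fA z1.
  have [l hl] := psum_is_cvg (norm_le_dilate z1 (norm_le_symm bB)).
  have := psum_cauchy_product (norm_le_dilate z1 (norm_le_symm fA)) hs hl.
  rewrite -dilateM ss dilate1 det0 mul0r => h.
  (* The partial sums of the constant series 1 tend to 1, and by [h] also to the product of the two
     determinant series at [z], which is 0. *)
  have : (1 : R[i]) = 0.
    apply: converges_unique h => e e0; exists 1%N => -[//|n _].
    rewrite /psum big_ord_recl big1 => [|k _]; last by rewrite coef1_fps.
    by rewrite coef1_fps addr0 subrr abv0 ltW.
  by move/eqP; rewrite oner_eq0.
- move=> h p /ball_closure p1 p0.
  have [u [z [u0 up zE]]] := conjugate_to_slice hij p.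
  have z1 : cabs z <= 1 by rewrite zE.
  apply: (h z); first exact/slice_closure.
  have [] := omega_row_eval hij fA u0 up z1; set v := \row_k _ => vz vw.
  apply/eqP/det0P; exists v.
    apply: contraNneq u0 => v0; rewrite (zwpart_decomp u hij).
    have := congr1 (fun x : 'rV_2 => x 0 0) v0; rewrite !mxE /= => ->.
    have := congr1 (fun x : 'rV_2 => x 0 1) v0; rewrite !mxE /= => ->.
    by rewrite raddf0 mul0r addr0.
  apply/rowP => k; rewrite [RHS]mxE; move: vz vw.
  rewrite p0 mulr0 !raddf0 => vz vw.
  by case: k => -[|[|//]] k2; [rewrite vz|rewrite vw]; congr (_ _ _); apply: val_inj.
- move=> h.
  have det0 z : cabs z <= 1 -> \det (omega i j f z) <> 0.
    move=> z1 /eqP/det0P[v v0 vo].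
    pose u := slice i (v 0 0) + slice i (v 0 1) * j.
    have [uz uw] := zwpart_uniq (v 0 0) (v 0 1) hij.
    have u0 : u != 0.
      apply: contraNneq v0 => u0; apply/eqP/rowP => k; rewrite mxE.
      move: uz uw; rewrite -/u u0 !raddf0 => uz uw.
      by case: k => -[|[|//]] k2; [rewrite uz|rewrite uw]; congr (_ _ _); apply: val_inj.
    have [r [ur ru]] := quaternion_inv_exists u0; pose p := r * slice i z * u.
    have up : u * p = slice i z * u by rewrite /p !mulrA ur mul1r.
    have pE : `|p| = cabs z.
      have : `|u| != 0 by rewrite normr_eq0.
      by move/mulfI; apply; rewrite -normqM up normqM (norm_slice hij) mulrC.
    apply: (h p); first by apply/ball_closure; rewrite pE.
    have [] := omega_row_eval hij fA u0 up z1; set w := \row_k _.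
    have -> : w = v.
      apply/rowP => k; rewrite mxE uz uw.
      by case: k => -[|[|//]] k2 /=; congr (_ _ _); apply: val_inj.
    rewrite vo !mxE => ez ew.
    have ue : u * wiener_plus_eval f p = 0.
      by rewrite (zwpart_decomp (u * _) hij) ez ew raddf0 mul0r addr0.
    by rewrite -[LHS]mul1r -ru -mulrA ue mulr0.
  pose F := map_fps (real_complex R) (symm_fps s).
  have FA := norm_le_symm fA; rewrite -/F in FA.
  have [|d [n0 [d0 Fd]]] := trunc_lower_bound FA.
    by move=> z z1 h0; apply: (det0 z z1); apply: converges_unique (det_omega hij fA z1) h0.
  (* The constant coefficient is the value at 0 of any nonempty truncation, whence the length
     [n0.+1]. *)
  have c0 : coef (symm_fps s) 0 != 0.
    have := Fd n0.+1 0 (leqnSn _); rewrite abv0 ler01 => /(_ isT).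
    rewrite horner_coef0 coef_trunc // /F cabs_real => h0.
    by rewrite -normr_gt0 (lt_le_trans d0).
  (* The inverse is taken over [R], so that its image among quaternionic series is central; its
     summability is read off from its complex image. *)
  have [G FG] := fps_inv_exists_field c0.
  have [|B GB] := @wiener_inverse_summable _ F (map_fps (real_complex R) G) _ d n0 _ FA d0 Fd.
    by rewrite -rmorphM FG rmorph1.
  apply/(wiener_plus_invertibleP hf); exists (conj_fps s * map_fps (in_alg _) G); split.
  + exists (A * B); apply: norm_leM (norm_le_conj fA) _ => m.
    apply: le_trans (GB m); apply: ler_sum => k _.
    by rewrite cabs_real qabsE /= normrZ normq1 mulr1.
  + by rewrite mulrA -symm_fpsE -rmorphM FG rmorph1.
  + by rewrite -mulrA map_in_alg_central mulrA -symm_fpsC -rmorphM FG rmorph1.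
Qed.
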